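(* For every integer $m\ge 2$ there exists $\alpha\in K^{(2)}$ such that $\mathrm{Hw}(\alpha)=q^{-m}$.
   Context: Let $q$ be a positive power of a prime, $R=\mathbb F_q[Y]$, $K=\mathbb F_q(Y)$, $\widehat K=\mathbb F_q((Y^{-1}))$ with absolute value $|P/Q|=q^{\deg P-\deg Q}$ extended to $\widehat K$. Let $K^{(2)}=\{f\in\widehat K:[K(f):K]=2\}$; for $\alpha\in K^{(2)}$, $\alpha^\sigma$ is its Galois conjugate over $K$, and $\Theta_\alpha=\mathrm{PGL}_2(R)\cdot\{\alpha,\alpha^\sigma\}$ (projective action by homographies on $\widehat K\cup\{\infty\}$). For $f\in\widehat K\setminus(K\cup\Theta_\alpha)$, $c_\alpha(f)=\liminf_{\beta\in\Theta_\alpha,\ |\beta-\beta^\sigma|\to0}\frac{|f-\beta|}{|\beta-\beta^\sigma|}$, and $\mathrm{Sp}(\alpha)=\{c_\alpha(f): f\in\widehat K\setminus(K\cup\Theta_\alpha)\}$. The quadratic Hurwitz constant is $\mathrm{Hw}(\alpha)=\max \mathrm{Sp}(\alpha)$ (this maximum exists and lies in $q^{\mathbb Z}$). *)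

(* Defs.v *)
From HB Require Import structures.
From mathcomp Require Import all_boot all_order all_algebra all_field.
From mathcomp Require Import all_classical all_reals ereal.
Unset Printing Implicit Defensive.
Import Order.TTheory GRing.Theory Num.Theory.
Local Open Scope classical_set_scope.
Local Open Scope ring_scope.

(* F plays the role of F_q, q = #|F|;  R = F[Y] is {poly F}.                   *)
(* Laurent series in Y^{-1}: a coefficient function c : int -> F, where c n    *)
(* is the coefficient of Y^n.  Khat F is the set of those with support bounded *)
(* above, i.e. the field F((Y^{-1})).                                          *)
Definition LS (F : finFieldType) := int -> F.

Definition Khat (F : finFieldType) : set (LS F) :=
  [set f | exists N : int, forall n : int, N < n -> f n = 0].

Section Laurent.
Variable F : finFieldType.

Definition ls_add (f g : LS F) : LS F := fun n => f n + g n.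
Definition ls_opp (f : LS F) : LS F := fun n => - f n.
Definition ls_sub (f g : LS F) : LS F := ls_add f (ls_opp g).
(* Cauchy product: coefficient of Y^n is sum_{i+j=n} f_i g_j; for elements of *)
(* Khat only finitely many terms are nonzero (finitely supported sum).         *)
Definition ls_mul (f g : LS F) : LS F :=
  fun n => \sum_(i \in [set: int]) f i * g (n - i).

Definition ls_poly (P : {poly F}) : LS F :=
  fun n => match n with Posz k => P`_k | Negz _ => 0 end.

(* the absolute value |f| = q^{deg f}, |0| = 0 (sup of the empty set is 0) *)
Definition ls_abs (R : realType) (f : LS F) : R :=
  sup [set ((#|F|%:R : R) ^ n) | n in [set n : int | f n != 0]].

Definition inK (f : LS F) : Prop :=
  exists P Q : {poly F}, Q != 0 /\ ls_mul (ls_poly Q) f = ls_poly P.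

(* [K(f):K] = 2 : f not in K and f is a root of a nonzero polynomial of degree *)
(* at most 2 over R = F[Y] (denominators cleared)                              *)
Definition K2 (f : LS F) : Prop :=
  f \in @Khat F /\ ~ inK f /\
  exists A B C : {poly F}, (A != 0 \/ B != 0 \/ C != 0) /\
    ls_add (ls_add (ls_mul (ls_poly A) (ls_mul f f)) (ls_mul (ls_poly B) f))
           (ls_poly C) = (fun _ => 0).

(* g is the Galois conjugate of f over K: f in K^(2), A f^2 + B f + C = 0 with *)
(* A,B,C in F[Y], A <> 0 (necessarily the minimal polynomial up to a scalar),  *)
(* and f + g = -B/A, i.e. A (f + g) = - B.                                     *)
Definition galconj (f g : LS F) : Prop :=
  K2 f /\ g \in @Khat F /\
  exists A B C : {poly F}, A != 0 /\
    ls_add (ls_add (ls_mul (ls_poly A) (ls_mul f f)) (ls_mul (ls_poly B) f))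
           (ls_poly C) = (fun _ => 0) /\
    ls_mul (ls_poly A) (ls_add f g) = ls_poly (- B).

(* y = g . x for the homography g = [[a, b], [c, d]] in PGL_2(F[Y])            *)
(* (ad - bc a unit of F[Y]), i.e. y (c x + d) = a x + b, c x + d <> 0.         *)
Definition homog_image (x y : LS F) : Prop :=
  y \in @Khat F /\
  exists a b c d : {poly F}, (a * d - b * c) \is a GRing.unit /\
    ls_add (ls_mul (ls_poly c) x) (ls_poly d) <> (fun _ => 0) /\
    ls_mul y (ls_add (ls_mul (ls_poly c) x) (ls_poly d))
      = ls_add (ls_mul (ls_poly a) x) (ls_poly b).

Definition Theta (alpha : LS F) : set (LS F) :=
  [set beta | exists alpha', galconj alpha alpha' /\
     (homog_image alpha beta \/ homog_image alpha' beta)].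

(* c_alpha(f) = liminf_{beta in Theta_alpha, |beta - beta^sigma| -> 0}         *)
(*               |f - beta| / |beta - beta^sigma|                              *)
(*  = sup_{eps > 0} inf { ratio | beta in Theta_alpha, |beta-beta^sigma|<eps } *)
Definition c_alpha (R : realType) (alpha f : LS F) : \bar R :=
  ereal_sup [set ereal_inf
     [set r : \bar R | exists beta beta' : LS F,
        Theta alpha beta /\ galconj beta beta' /\
        ls_abs R (ls_sub beta beta') < eps /\
        r = (ls_abs R (ls_sub f beta) / ls_abs R (ls_sub beta beta'))%:E]
     | eps in [set eps : R | 0 < eps]].

Definition Sp (R : realType) (alpha : LS F) : set (\bar R) :=
  [set c_alpha R alpha f | f in [set f | f \in @Khat F /\ ~ inK f /\ ~ Theta alpha f]].

Definition Hw_eq (R : realType) (alpha : LS F) (h : \bar R) : Prop :=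
  Sp R alpha h /\ forall x, Sp R alpha x -> (x <= h)%E.

End Laurent.

Arguments ls_add {F}. Arguments ls_opp {F}. Arguments ls_sub {F}.
Arguments ls_mul {F}. Arguments ls_poly {F}. Arguments ls_abs {F}.
Arguments inK {F}. Arguments K2 {F}. Arguments galconj {F}.
Arguments homog_image {F}. Arguments Theta {F}. Arguments c_alpha {F}.
Arguments Sp {F}. Arguments Hw_eq {F}.

(* Main.v *)
Require Import Defs.
From HB Require Import structures.
From mathcomp Require Import all_boot all_order all_algebra all_field.
From mathcomp Require Import all_classical all_reals ereal.
From mathcomp Require Import zify ring lra.
Set Implicit Arguments.
Unset Strict Implicit.
Unset Printing Implicit Defensive.
Import Order.TTheory GRing.Theory Num.Theory.
Local Open Scope classical_set_scope.
Local Open Scope ring_scope.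

(* Write d(z) for |z - z^sigma|, and for coprime (u, w) put
   N_z(u, w) = |u - z w| |u - z^sigma w|.

   Take alpha with a purely periodic continued fraction whose period contains
   every admissible word: all partial quotients have degree between 1 and m - 1,
   consecutive degrees add up to at most m, and every such word of length at most
   m occurs, preceded both by Y and by Y + 1.

   Lower bound.  For alpha, a primitive vector with N < d is, up to a unit and the
   period automorphism, a convergent; hence the degree condition gives
   N(e1) >= q^-m d and N(e1) N(e2) >= q^-m d^2 for every basis (e1, e2) of R^2, and
   these inequalities pass to all of Theta_alpha.  Applied to two consecutive
   convergents of f = [Y^(m+1); Y^(m+1), ...] they force |f - beta| >= q^-m d(beta)
   for every beta in Theta_alpha.

   Upper bound.  Given an irrational f = [c_0; c_1, ...], replace its n-th complete
   quotient y by a tail x of alpha with |1/x - 1/y| <= q^-(m-1) that is preceded in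
   alpha by a degree-one quotient different from c_(n-1).  The resulting beta
   satisfies |f - beta| <= q^-m d(beta), and d(beta) tends to 0. *)

(** * The field of Laurent series *)

Identity Coercion LS_fun : LS >-> Funclass.

Section RawSeries.
Variable F : finFieldType.
Implicit Types f g h : LS F.

Definition ls_bound f (N : int) := forall n : int, N < n -> f n = 0.

(** Coefficients are read downwards from [Y^N], so that up to order [k] the Cauchy product of series
    becomes a product of polynomials. The ring laws are then inherited from [{poly F}]. *)
Definition ls_trunc (N : int) (k : nat) f : {poly F} :=
  \poly_(i < k) f (N - i%:Z).

Definition ls_mono (c : F) (N : int) : LS F := fun n => if n == N then c else 0.

Lemma ls_bound_le f N M : N <= M -> ls_bound f N -> ls_bound f M.
Proof. by move=> NM fN n Mn; apply: fN; exact: le_lt_trans Mn. Qed.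

Lemma ls_mulE f g N M (k j : nat) : ls_bound f N -> ls_bound g M -> (j < k)%N ->
  ls_mul f g (N + M - j%:Z) = (ls_trunc N k f * ls_trunc M k g)`_j.
Proof.
move=> fN gM jk; rewrite /ls_mul.
rewrite (fsbigE [seq N - i%:Z | i <- iota 0 j.+1]) //; first last.
- move=> i _ Hi.
  have [Ni|iN] := ltP N i; first by rewrite fN // mul0r.
  have [ji|ij] := ltP (i + j%:Z) N.
    by rewrite [g _]gM ?mulr0 //; lia.
  case/negP: Hi; apply/mapP; exists `|N - i|%N; first by rewrite mem_iota; lia.
  by lia.
- by rewrite map_inj_uniq ?iota_uniq // => a b /=; lia.
rewrite big_map coefM -(big_mkord xpredT
  (fun i => (ls_trunc N k f)`_i * (ls_trunc M k g)`_(j - i))).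
rewrite /index_iota subn0 big_seq_cond [RHS]big_seq_cond.
apply: eq_big => [i|i]; first by rewrite in_setT.
rewrite mem_iota => /andP[/andP[_ ij] _].
rewrite !coef_poly.
have -> : (i < k)%N by lia.
have -> : (j - i < k)%N by lia.
congr (_ * g _); lia.
Qed.

Lemma ls_mul_bound f g N M :
  ls_bound f N -> ls_bound g M -> ls_bound (ls_mul f g) (N + M).
Proof.
move=> fN gM n NMn; rewrite /ls_mul fsbig1 // => i _.
have [Ni|iN] := ltP N i; first by rewrite fN // mul0r.
by rewrite [g _]gM ?mulr0 //; lia.
Qed.

Lemma ls_mul_lead f g N M : ls_bound f N -> ls_bound g M ->
  ls_mul f g (N + M) = f N * g M.
Proof.
move=> fN gM; have := @ls_mulE f g N M 1 0 fN gM isT.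
by rewrite !subr0 => ->; rewrite coefM big_ord1 !coef_poly /= !subr0.
Qed.

Lemma ls_bound_ext f g N : ls_bound f N -> ls_bound g N ->
  (forall j : nat, f (N - j%:Z) = g (N - j%:Z)) -> f = g.
Proof.
move=> fN gN fg; apply/funext => n.
have [Nn|nN] := ltP N n; first by rewrite fN ?gN.
by have -> : n = N - `|N - n|%N%:Z by lia.
Qed.

Lemma ls_mulC_bound f g N M : ls_bound f N -> ls_bound g M ->
  ls_mul f g = ls_mul g f.
Proof.
move=> fN gM; apply: (@ls_bound_ext _ _ (N + M)).
- exact: ls_mul_bound.
- by rewrite addrC; exact: ls_mul_bound.
move=> j; rewrite (ls_mulE (k := j.+1)) // [N + M]addrC (ls_mulE (k := j.+1)) //.
by rewrite mulrC.
Qed.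

Lemma coef_ls_trunc_mul f g N M k i : ls_bound f N -> ls_bound g M ->
  (i < k)%N -> (ls_trunc (N + M) k (ls_mul f g))`_i =
  (ls_trunc N k f * ls_trunc M k g)`_i.
Proof. by move=> fN gM ik; rewrite coef_poly ik (ls_mulE (k := k)). Qed.

Lemma ls_mulA_bound f g h N M L :
  ls_bound f N -> ls_bound g M -> ls_bound h L ->
  ls_mul f (ls_mul g h) = ls_mul (ls_mul f g) h.
Proof.
move=> fN gM hL; apply: (@ls_bound_ext _ _ (N + M + L)).
- by rewrite -addrA; do 2?apply: ls_mul_bound.
- by do 2?apply: ls_mul_bound.
move=> j; rewrite {1}(_ : N + M + L - j%:Z = N + (M + L) - j%:Z); last lia.
rewrite !(ls_mulE (k := j.+1)) //; try exact: ls_mul_bound.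
transitivity ((ls_trunc N j.+1 f * ls_trunc M j.+1 g * ls_trunc L j.+1 h)`_j).
  rewrite -mulrA [LHS]coefM [RHS]coefM; apply: eq_bigr => i _.
  by rewrite coef_ls_trunc_mul //; lia.
rewrite [LHS]coefM [RHS]coefM; apply: eq_bigr => i _.
by rewrite coef_ls_trunc_mul //; lia.
Qed.

Lemma ls_mulDl_bound f g h N M : ls_bound f N -> ls_bound g N -> ls_bound h M ->
  ls_mul (ls_add f g) h = ls_add (ls_mul f h) (ls_mul g h).
Proof.
move=> fN gN hM.
have fgN : ls_bound (ls_add f g) N by move=> n Nn; rewrite /ls_add fN ?gN ?addr0.
apply: (@ls_bound_ext _ _ (N + M)).
- exact: ls_mul_bound.
- by move=> n Nn; rewrite /ls_add !(ls_mul_bound (N := N) (M := M)) ?addr0.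
move=> j; rewrite {2}/ls_add !(ls_mulE (k := j.+1)) // -coefD -mulrDl.
congr (nth 0 (polyseq (_ * _)) j); apply/polyP => i; rewrite coefD !coef_poly.
by case: ifP => // _; rewrite addr0.
Qed.

Lemma ls_mono_mul c N f n : ls_mul (ls_mono c N) f n = c * f (n - N).
Proof.
rewrite /ls_mul (fsbigE [:: N]) //=; last first.
  by move=> i _; rewrite inE /ls_mono => /negPf ->; rewrite mul0r.
by rewrite big_cons big_nil in_setT addr0 /ls_mono eqxx.
Qed.

Lemma ls_mono_bound c N : ls_bound (ls_mono c N) N.
Proof. by move=> n; rewrite /ls_mono; case: eqP => // ->; rewrite ltxx. Qed.

Lemma ls_poly_bound P : ls_bound (@ls_poly F P) ((size P)%:Z - 1).
Proof. by case=> n //= Pn; rewrite nth_default //; lia. Qed.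

Lemma ls_bound_common f g : @Khat F f -> @Khat F g ->
  exists N, ls_bound f N /\ ls_bound g N.
Proof.
move=> [N fN] [M gM]; exists (Num.max N M).
by split; [apply: ls_bound_le fN|apply: ls_bound_le gM]; rewrite le_max lexx ?orbT.
Qed.

End RawSeries.

(** Membership is stored as a boolean, so that series with the same coefficients are equal in the
    subtype. *)
Record ser (F : finFieldType) := Ser { ser_val :> LS F; _ : `[< @Khat F ser_val >] }.

(** * The series as a complete field containing the polynomials *)

Section SeriesRing.
Variable F : finFieldType.
Implicit Types x y z : ser F.

HB.instance Definition _ := [isSub for @ser_val F].
HB.instance Definition _ := gen_eqMixin (ser F).
HB.instance Definition _ := gen_choiceMixin (ser F).

Lemma serP x : @Khat F x.
Proof. by case: x => f /= /asboolP. Qed.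

Lemma ser_inj x y : ser_val x = ser_val y -> x = y.
Proof. by move=> /(@val_inj _ _ (ser F)). Qed.

Definition mkser (f : LS F) (hf : @Khat F f) : ser F := Ser (asboolT hf).

Lemma Khat_add x y : @Khat F (ls_add x y).
Proof.
have [N [xN yN]] := ls_bound_common (serP x) (serP y).
by exists N => n Nn; rewrite /ls_add xN ?yN ?addr0.
Qed.

Lemma Khat_opp x : @Khat F (ls_opp x).
Proof. by have [N xN] := serP x; exists N => n Nn; rewrite /ls_opp xN ?oppr0. Qed.

Lemma Khat_mul x y : @Khat F (ls_mul x y).
Proof.
have [N xN] := serP x; have [M yM] := serP y.
by exists (N + M); exact: ls_mul_bound.
Qed.

Lemma Khat_mono c N : @Khat F (ls_mono c N).
Proof. by exists N; exact: ls_mono_bound. Qed.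

Lemma Khat_poly P : @Khat F (ls_poly P).
Proof. by exists ((size P)%:Z - 1); exact: ls_poly_bound. Qed.

Definition ser_mono c N := mkser (Khat_mono c N).
Definition ser_add x y := mkser (Khat_add x y).
Definition ser_opp x := mkser (Khat_opp x).
Definition ser_mul x y := mkser (Khat_mul x y).
Definition sp (P : {poly F}) := mkser (Khat_poly P).

Lemma ser_addA : associative ser_add.
Proof. by move=> x y z; apply/ser_inj/funext => n; exact: addrA. Qed.
Lemma ser_addC : commutative ser_add.
Proof. by move=> x y; apply/ser_inj/funext => n; exact: addrC. Qed.
Lemma ser_add0 : left_id (ser_mono 0 0) ser_add.
Proof.
by move=> x; apply/ser_inj/funext => n /=; rewrite /ls_add /ls_mono if_same add0r.
Qed.
Lemma ser_addN : left_inverse (ser_mono 0 0) ser_opp ser_add.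
Proof.
move=> x; apply/ser_inj/funext => n /=.
by rewrite /ls_add /ls_opp /ls_mono if_same addNr.
Qed.

HB.instance Definition _ :=
  GRing.isZmodule.Build (ser F) ser_addA ser_addC ser_add0 ser_addN.

Lemma ser_mulA : associative ser_mul.
Proof.
move=> x y z; apply/ser_inj.
have [N xN] := serP x; have [M yM] := serP y; have [L zL] := serP z.
exact: (ls_mulA_bound xN yM zL).
Qed.
Lemma ser_mulC : commutative ser_mul.
Proof.
move=> x y; apply/ser_inj; have [N xN] := serP x; have [M yM] := serP y.
exact: (ls_mulC_bound xN yM).
Qed.
Lemma ser_mul1 : left_id (ser_mono 1 0) ser_mul.
Proof.
by move=> x; apply/ser_inj/funext => n /=; rewrite ls_mono_mul subr0 mul1r.
Qed.
Lemma ser_mulDl : left_distributive ser_mul +%R.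
Proof.
move=> x y z; apply/ser_inj.
have [N [xN yN]] := ls_bound_common (serP x) (serP y); have [M zM] := serP z.
exact: (ls_mulDl_bound xN yN zM).
Qed.
Lemma ser_1neq0 : ser_mono 1 0 != 0.
Proof.
apply/eqP => /(congr1 (fun x : ser F => x 0)) /=.
by rewrite /ls_mono /= => /eqP; rewrite oner_eq0.
Qed.

HB.instance Definition _ := GRing.Zmodule_isComNzRing.Build (ser F)
  ser_mulA ser_mulC ser_mul1 ser_mulDl ser_1neq0.

Lemma serD x y n : (x + y) n = x n + y n. Proof. by []. Qed.
Lemma serN x n : (- x) n = - x n. Proof. by []. Qed.
Lemma serB x y n : (x - y) n = x n - y n. Proof. by []. Qed.
Lemma ser0 n : (0 : ser F) n = 0.
Proof. by rewrite [LHS]/(ls_mono 0 0 n) /ls_mono if_same. Qed.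
Lemma ser1E : 1 = ser_mono 1 0. Proof. by []. Qed.

Lemma serext x y : (forall n : int, x n = y n) -> x = y.
Proof. by move=> xy; apply/ser_inj/funext. Qed.

Lemma bound0 N : ls_bound (0 : ser F) N.
Proof. by move=> n _; exact: ser0. Qed.
Lemma boundD x y N : ls_bound x N -> ls_bound y N -> ls_bound (x + y) N.
Proof. by move=> xN yN n Nn; rewrite serD xN ?yN ?addr0. Qed.
Lemma boundN x N : ls_bound x N -> ls_bound (- x) N.
Proof. by move=> xN n Nn; rewrite serN xN ?oppr0. Qed.
Lemma boundB x y N : ls_bound x N -> ls_bound y N -> ls_bound (x - y) N.
Proof. by move=> xN yN; apply: boundD => //; exact: boundN. Qed.
Lemma boundM x y N M : ls_bound x N -> ls_bound y M -> ls_bound (x * y) (N + M).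
Proof. exact: ls_mul_bound. Qed.
Lemma bound1 : ls_bound (1 : ser F) 0.
Proof. exact: ls_mono_bound. Qed.

Lemma bound_eq0 x : (forall k : nat, ls_bound x (- k%:Z)) -> x = 0.
Proof.
by move=> xk; apply: serext => n; rewrite ser0; apply: (xk `|n|%N.+1); lia.
Qed.

Lemma ser_complete (u : nat -> ser F) :
  (forall n : nat, ls_bound (u n.+1 - u n) (- n%:Z)) ->
  exists l : ser F, forall n : nat, ls_bound (l - u n) (- n%:Z).
Proof.
move=> ucauchy.
have ustep (k n : nat) (j : int) : - k%:Z < j -> u (n + k)%N j = u k j.
  move=> kj; elim: n => // n <-; rewrite addSn; apply/eqP.
  by rewrite -subr_eq0 -serB ucauchy //; lia.
(* The coefficient of [Y^j] no longer changes from index [|j| + 1] on, because [-(|j| + 1) < j];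
   this diagonal is therefore the limit. *)
pose l : LS F := fun j => u `|j|%N.+1 j.
have lu (n : nat) (j : int) : - n%:Z < j -> l j = u n j.
  move=> nj; rewrite /l -(ustep `|j|%N.+1 n); last lia.
  by rewrite addnC ustep.
have lK : @Khat F l.
  have [N uN] := serP (u 0); exists (Num.max N 0) => j.
  by rewrite gt_max => /andP[Nj j0]; rewrite (lu 0%N) //; exact: uN.
exists (mkser lK) => n j nj; rewrite serB /= (lu n) // subrr //.
Qed.

Lemma ser_lead x : x != 0 -> exists N, x N != 0 /\ ls_bound x N.
Proof.
move=> x0; have [N xN] := serP x.
have [n xn] : exists n, x n != 0.
  apply: contrapT => H; move/eqP: x0; apply; apply: serext => n.
  by rewrite ser0; apply/eqP; apply: contrapT => /negP xn; apply: H; exists n.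
have ex : exists k, x (N - k%:Z) != 0.
  exists `|N - n|%N; have -> : N - `|N - n|%N%:Z = n; last by [].
  have : n <= N by rewrite leNgt; apply/negP => /xN /eqP; rewrite (negPf xn).
  by lia.
have [k xk kmin] := ex_minnP ex; exists (N - k%:Z); split=> // j kj.
apply: contrapT => /eqP xj.
have jN : j <= N by rewrite leNgt; apply/negP => /xN /eqP; rewrite (negPf xj).
have := kmin `|N - j|%N; have -> : N - `|N - j|%N%:Z = j by lia.
by move=> /(_ xj); lia.
Qed.

Lemma bound_exp x (k : nat) : ls_bound x (-1) -> ls_bound (x ^+ k) (- k%:Z).
Proof.
move=> xb; elim: k => [|k IH]; first exact: bound1.
rewrite exprS; have -> : - k.+1%:Z = - 1 - k%:Z by lia.
exact: boundM.
Qed.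

(** The partial sums of the geometric series are Cauchy, and [u k * (1 - x) = 1 - x ^+ k] passes to
    the limit. *)
Lemma geometric_inv x : ls_bound x (-1) -> exists y, y * (1 - x) = 1.
Proof.
move=> xb; pose u (n : nat) := \sum_(i < n) x ^+ i.
have uS n : u n.+1 - u n = x ^+ n by rewrite /u big_ord_recr /= addrAC subrr add0r.
have [l lu] : exists l : ser F, forall n : nat, ls_bound (l - u n) (- n%:Z).
  by apply: ser_complete => n; rewrite uS; exact: bound_exp.
exists l; apply/eqP; rewrite -subr_eq0; apply/eqP; apply: bound_eq0 => k.
have uE : u k * (1 - x) = 1 - x ^+ k.
  by rewrite -[in RHS](expr1n _ k) subrXX mulrC; congr (_ * _); apply: eq_bigr => i _;
    rewrite expr1n mul1r.
have -> : l * (1 - x) - 1 = (l - u k) * (1 - x) - x ^+ k.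
  by rewrite mulrBl uE; ring.
apply: boundB; last exact: bound_exp.
rewrite -[X in ls_bound _ X]addr0; apply: boundM => //.
by apply: boundB; [exact: bound1|exact: ls_bound_le xb].
Qed.

Lemma ser_invertible x : x != 0 -> exists y, y * x = 1.
Proof.
move=> /ser_lead[N [xN bx]].
(* Division by the leading term brings [x] to the form 1 minus a series of negative degree, to which
   the geometric series applies. *)
pose c := ser_mono (x N)^-1 (- N).
have xb : ls_bound (1 - c * x) (-1).
  move=> n n1; rewrite serB [(c * x) n]ls_mono_mul opprK.
  have [->|n0] := eqVneq n 0.
    by rewrite add0r mulVf // ser1E /= /ls_mono eqxx subrr.
  rewrite ser1E /= /ls_mono (negPf n0) (bx (n + N)) ?mulr0 ?subr0 //; lia.
have [y yE] := geometric_inv xb.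
exists (y * c); rewrite -mulrA -[RHS]yE; congr (_ * _); ring.
Qed.

Definition ser_inv x : ser F :=
  match pselect (x != 0) with
  | left x0 => projT1 (cid (ser_invertible x0))
  | right _ => 0
  end.

Lemma ser_mulVf x : x != 0 -> ser_inv x * x = 1.
Proof.
by rewrite /ser_inv; case: pselect => // x0 _; case: cid.
Qed.

Lemma ser_inv0 : ser_inv 0 = 0.
Proof. by rewrite /ser_inv; case: pselect => // x0; case/eqP: (x0). Qed.

HB.instance Definition _ := GRing.ComNzRing_isField.Build (ser F)
  ser_mulVf ser_inv0.

Lemma sp_additive : zmod_morphism sp.
Proof.
by move=> P Q; apply: serext => -[n|n]; rewrite serB /= ?coefB ?subr0.
Qed.
HB.instance Definition _ := GRing.isZmodMorphism.Build _ _ sp sp_additive.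

Lemma spC c : sp c%:P = ser_mono c 0.
Proof. by apply: serext => -[[|n]|n] //=; rewrite coefC. Qed.

Lemma spMX P : sp (P * 'X) = ser_mono 1 1 * sp P.
Proof.
apply: serext => n; rewrite [RHS]ls_mono_mul mul1r /=.
case: n => [[|n]|n] //=; first by rewrite coefMX.
by rewrite coefMX /= subn1.
Qed.

Lemma spCM c P : sp (c%:P * P) = sp c%:P * sp P.
Proof.
rewrite spC; apply: serext => n; rewrite [RHS]ls_mono_mul subr0 /=.
by case: n => n /=; rewrite ?coefCM ?mulr0.
Qed.

(** Horner induction on the first factor reduces to products by a constant and by [Y], which are
    products by a monomial. *)
Lemma sp_multiplicative : monoid_morphism sp.
Proof.
split=> [|P Q]; first by rewrite -polyC1 spC.
elim/poly_ind: P => [|P c IH]; first by rewrite mul0r raddf0 mul0r.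
by rewrite mulrDl !raddfD /= spCM mulrDl mulrAC !spMX IH mulrA.
Qed.
HB.instance Definition _ := GRing.isMonoidMorphism.Build _ _ sp sp_multiplicative.

End SeriesRing.

(** * The absolute value *)

Section AbsoluteValue.
Variables (F : finFieldType) (R : realType).
Implicit Types x y z : ser F.

Definition nu x : R := ls_abs R x.

Let q : R := #|F|%:R.

Lemma q_gt1 : 1 < q.
Proof. by rewrite ltr1n finNzRing_gt1. Qed.

Lemma q_gt0 : 0 < q. Proof. exact: lt_trans ltr01 q_gt1. Qed.
Hint Resolve q_gt0 q_gt1 : core.

Lemma q_neq0 : q != 0. Proof. by rewrite gt_eqF. Qed.
Hint Resolve q_neq0 : core.

Lemma ler_qX (n k : int) : (q ^ n <= q ^ k) = (n <= k).
Proof. by rewrite ler_eXz2l. Qed.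
Lemma ltr_qX (n k : int) : (q ^ n < q ^ k) = (n < k).
Proof. by rewrite ltr_eXz2l. Qed.
Lemma qX_gt0 (n : int) : 0 < q ^ n. Proof. exact: exprz_gt0. Qed.
Hint Resolve qX_gt0 : core.

Lemma nu_lead x N : x N != 0 -> ls_bound x N -> nu x = q ^ N.
Proof.
move=> xN bx; rewrite /nu /ls_abs.
set A := (X in sup X).
have AN : A (q ^ N) by exists N.
have ubA : ubound A (q ^ N).
  move=> _ [n /= xn <-]; rewrite ler_qX leNgt; apply/negP => /bx /eqP.
  by rewrite (negPf xn).
apply/eqP; rewrite eq_le; apply/andP; split.
  by apply: ge_sup => //; exists (q ^ N).
by apply: ub_le_sup => //; exists (q ^ N).
Qed.

Lemma nu0 : nu 0 = 0.
Proof.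
rewrite /nu /ls_abs (_ : [set _ | n in _] = set0) ?sup0 //.
by rewrite -subset0 => r [n hn]; move: hn; rewrite /mkset ser0 eqxx.
Qed.

Lemma nuP x : x = 0 \/ exists N, [/\ nu x = q ^ N, x N != 0 & ls_bound x N].
Proof.
have [->|/ser_lead[N [xN bx]]] := eqVneq x 0; first by left.
by right; exists N; split => //; exact: nu_lead.
Qed.

Lemma nu_ge0 x : 0 <= nu x.
Proof. by case: (nuP x) => [->|[N [-> _ _]]]; [rewrite nu0|exact: ltW]. Qed.
Hint Resolve nu_ge0 : core.

Lemma nu_eq0 x : (nu x == 0) = (x == 0).
Proof.
case: (nuP x) => [->|[N [-> xN _]]]; first by rewrite nu0 !eqxx.
rewrite gt_eqF //; apply/esym/eqP => x0; case/eqP: xN; rewrite x0; exact: ser0.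
Qed.

Lemma nu_gt0 x : (0 < nu x) = (x != 0).
Proof. by rewrite lt0r nu_eq0 nu_ge0 andbT. Qed.

Lemma nu_le_bound x N : (nu x <= q ^ N) <-> ls_bound x N.
Proof.
case: (nuP x) => [->|[M [-> xM bx]]].
  by rewrite nu0; split=> _; [exact: bound0|exact: ltW].
rewrite ler_qX; split=> [MN|xN]; first exact: ls_bound_le bx.
by rewrite leNgt; apply/negP => /xN /eqP; rewrite (negPf xM).
Qed.

Lemma nuM x y : nu (x * y) = nu x * nu y.
Proof.
case: (nuP x) => [->|[N [-> xN bx]]]; first by rewrite mul0r nu0 mul0r.
case: (nuP y) => [->|[M [-> yM by_]]]; first by rewrite mulr0 nu0 mulr0.
rewrite -expfzDr //; apply: nu_lead; last exact: boundM.
by rewrite [(x * y) _](ls_mul_lead bx by_) mulf_neq0.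
Qed.

Lemma nu1 : nu 1 = 1.
Proof.
rewrite (@nu_lead _ 0) ?expr0z //; last exact: bound1.
by rewrite ser1E /= /ls_mono eqxx oner_neq0.
Qed.

Lemma nuV x : nu x^-1 = (nu x)^-1.
Proof.
have [->|x0] := eqVneq x 0; first by rewrite invr0 nu0 invr0.
apply: (mulIf (x := nu x)); first by rewrite nu_eq0.
by rewrite mulVf ?nu_eq0 // -nuM mulVf // nu1.
Qed.

Lemma nuN x : nu (- x) = nu x.
Proof.
rewrite -mulN1r nuM (_ : nu (-1) = 1) ?mul1r //.
have : (nu (-1)) ^+ 2 = 1 by rewrite expr2 -nuM mulrNN mulr1 nu1.
by move/eqP; rewrite sqrf_eq1 => /orP[/eqP //|/eqP E]; have := nu_ge0 (-1); rewrite E; lra.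
Qed.

Lemma nuD x y : nu (x + y) <= Num.max (nu x) (nu y).
Proof.
case: (nuP x) => [->|[N [xE _ bx]]]; first by rewrite add0r le_max lexx orbT.
case: (nuP y) => [->|[M [yE _ by_]]]; first by rewrite addr0 le_max lexx.
rewrite le_max xE yE.
have [NM|/ltW MN] := leP N M; apply/orP; [right|left]; apply/nu_le_bound.
  by apply: boundD => //; exact: ls_bound_le bx.
by apply: boundD => //; exact: ls_bound_le by_.
Qed.

Lemma nuBC x y : nu (x - y) = nu (y - x).
Proof. by rewrite -nuN opprB. Qed.

Lemma nuD_le x y (r : R) : nu x <= r -> nu y <= r -> nu (x + y) <= r.
Proof. by move=> xr yr; apply: le_trans (nuD x y) _; rewrite ge_max xr. Qed.

Lemma nuB_le x y (r : R) : nu x <= r -> nu y <= r -> nu (x - y) <= r.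
Proof. by move=> xr yr; apply: nuD_le => //; rewrite nuN. Qed.

Lemma nuD_lt x y (r : R) : nu x < r -> nu y < r -> nu (x + y) < r.
Proof. by move=> xr yr; apply: le_lt_trans (nuD x y) _; rewrite gt_max xr. Qed.

Lemma nuDl x y : nu y < nu x -> nu (x + y) = nu x.
Proof.
move=> yx; apply/eqP; rewrite eq_le nuD_le ?(ltW yx) //= leNgt; apply/negP => xyx.
have : nu (x + y - y) < nu x by apply: nuD_lt; rewrite ?nuN.
by rewrite addrK ltxx.
Qed.

Lemma nuDr x y : nu x < nu y -> nu (x + y) = nu y.
Proof. by rewrite addrC; exact: nuDl. Qed.

Lemma nuBl x y : nu y < nu x -> nu (x - y) = nu x.
Proof. by move=> yx; apply: nuDl; rewrite nuN. Qed.

Lemma nuBr x y : nu x < nu y -> nu (x - y) = nu y.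
Proof. by move=> yx; rewrite nuBC nuBl. Qed.

Lemma nu_sp (P : {poly F}) : P != 0 -> nu (sp P) = q ^+ (size P).-1.
Proof.
move=> P0; apply: (@nu_lead _ (size P).-1%:Z).
  by rewrite /= -lead_coefE lead_coef_eq0.
have /ls_bound_le := @ls_poly_bound F P; apply.
by move: P0; rewrite -size_poly_gt0; lia.
Qed.

Lemma sp_eq0 (P : {poly F}) : (sp P == 0) = (P == 0).
Proof.
have [->|P0] := eqVneq P 0; first by rewrite raddf0 eqxx.
by rewrite -nu_eq0 nu_sp // expf_eq0 (negPf q_neq0) andbF.
Qed.

Lemma nu_sp_ge1 (P : {poly F}) : P != 0 -> 1 <= nu (sp P).
Proof. by move=> P0; rewrite nu_sp // exprn_ege1 // ltW. Qed.

Lemma nu_sp_lt1 (P : {poly F}) : nu (sp P) < 1 -> P = 0.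
Proof.
by move=> P1; apply/eqP; apply: contraTT P1 => /nu_sp_ge1; rewrite -leNgt.
Qed.

Lemma nu_sp_unit (P : {poly F}) : P \is a GRing.unit -> nu (sp P) = 1.
Proof.
rewrite poly_unitE => /andP[/eqP sP _].
by rewrite nu_sp ?sP // -size_poly_gt0 sP.
Qed.

Lemma nu_sp_gt1 (P : {poly F}) : (1 < nu (sp P)) = (1 < size P)%N.
Proof.
have [->|P0] := eqVneq P 0; first by rewrite raddf0 nu0 size_poly0 ltr10.
rewrite nu_sp //; have := P0; rewrite -size_poly_gt0.
case: (size P) => // -[|n] _; first by rewrite ltxx.
by rewrite /= exprn_egt1.
Qed.

(** The polynomial part, in the role of the integer part. The chosen support bound [N] may be
    negative; reading [|N| + 1] coefficients covers every case. *)
Definition ser_floor x : {poly F} :=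
  let N := projT1 (cid (serP x)) in \poly_(i < `|N|%N.+1) x i%:Z.

Lemma ser_floorP x : nu (x - sp (ser_floor x)) < 1.
Proof.
have /le_lt_trans : nu (x - sp (ser_floor x)) <= q ^ (-1); last first.
  by apply; rewrite -[ltRHS](expr0z q) ltr_qX.
apply/nu_le_bound => n n0; rewrite serB /= /ser_floor.
case: cid => N /= xN; case: n n0 => // n _ /=.
rewrite coef_poly; case: ltnP => [_|nN]; first by rewrite subrr.
by rewrite xN ?subr0 //; lia.
Qed.

Lemma ser_nu_complete (u : nat -> ser F) :
  (forall n, nu (u n.+1 - u n) <= q ^- n) ->
  exists l, forall n, nu (l - u n) <= q ^- n.
Proof.
move=> uc; have [|l lu] := @ser_complete F u.
  by move=> n; apply/nu_le_bound; rewrite -exprnN; exact: uc.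
by exists l => n; have /nu_le_bound := lu n; rewrite -exprnN.
Qed.

Lemma q_archi (r : R) : exists n : nat, r < q ^+ n.
Proof.
exists (Num.bound `|r|); apply: le_lt_trans (ler_norm r) _.
apply: lt_trans (archi_boundP (normr_ge0 r)) _.
by rewrite -natrX ltr_nat ltn_expl // finNzRing_gt1.
Qed.

Lemma nu_arbitrarily_small x : (forall k, nu x <= q ^- k) -> x = 0.
Proof. by move=> h; apply: bound_eq0 => k; apply/nu_le_bound; rewrite -exprnN. Qed.

End AbsoluteValue.

Local Hint Extern 0 (is_true (@Order.le _ _ _ _)) =>
  solve [apply: nu_ge0 | exact: ltW (q_gt0 _ _)] : core.
Local Hint Extern 0 (is_true (@Order.lt _ _ _ _)) =>
  solve [exact: q_gt0 | exact: q_gt1] : core.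

(** * Continued fractions *)

Section ContinuedFractions.
Variables (F : finFieldType) (R : realType).
Implicit Types (x : ser F) (b : nat -> {poly F}).

Local Notation v := (nu R).
Local Notation q := (#|F|%:R : R).

Definition irr x := forall P Q : {poly F}, Q != 0 -> sp Q * x <> sp P.

Fixpoint continuant (s t : {poly F}) b n : {poly F} :=
  match n with
  | 0 => s
  | n'.+1 => match n' with
             | 0 => t
             | n''.+1 => b n' * continuant s t b n' + continuant s t b n''
             end
  end.

(* Shifted indexing: [cnum b n.+1 / cden b n.+1] is [b_0; ...; b_n], and index 0
   is the formal convergent 1/0. *)
Definition cnum b := continuant 1 (b 0%N) b.
Definition cden b := continuant 0 1 b.

Lemma cnumSS b n : cnum b n.+2 = b n.+1 * cnum b n.+1 + cnum b n.
Proof. by []. Qed.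
Lemma cdenSS b n : cden b n.+2 = b n.+1 * cden b n.+1 + cden b n.
Proof. by []. Qed.

Lemma convergent_det b n :
  cnum b n.+1 * cden b n - cnum b n * cden b n.+1 = (-1) ^+ n.+1.
Proof.
elim: n => [|n IH]; first by rewrite /cnum /cden /= mulr0 mulr1 add0r expr1.
rewrite exprS -IH cnumSS cdenSS; ring.
Qed.

(** Strict growth makes [b_(n+1) Q_(n+1)] dominate [Q_n], which gives at once the exact size of
    [Q_(n+2)] and the next strict inequality; hence the joint proof. *)
Lemma cden_growth b : (forall n, (1 < size (b n.+1))%N) ->
  forall n, v (sp (cden b n)) < v (sp (cden b n.+1)) /\
    v (sp (cden b n.+2)) = v (sp (b n.+1)) * v (sp (cden b n.+1)).
Proof.
move=> hb.
have gap n : v (sp (cden b n)) < v (sp (cden b n.+1)) ->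
    v (sp (cden b n.+1)) < v (sp (cden b n.+2)) /\
    v (sp (cden b n.+2)) = v (sp (b n.+1)) * v (sp (cden b n.+1)).
  move=> lt; have b1 : 1 < v (sp (b n.+1)) by rewrite nu_sp_gt1.
  have Q0 : 0 < v (sp (cden b n.+1)) by apply: le_lt_trans _ lt.
  have lt2 : v (sp (cden b n.+1)) < v (sp (b n.+1)) * v (sp (cden b n.+1)).
    by rewrite ltr_pMl.
  have E : v (sp (cden b n.+2)) = v (sp (b n.+1)) * v (sp (cden b n.+1)).
    by rewrite cdenSS rmorphD rmorphM /= nuDl nuM // (lt_trans lt).
  by rewrite E.
have lt n : v (sp (cden b n)) < v (sp (cden b n.+1)).
  elim: n => [|n IH]; last by have [] := gap n IH.
  by rewrite /cden /= raddf0 rmorph1 nu0 nu1.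
by move=> n; split => //; case: (gap n (lt n)).
Qed.

Lemma q_le_nu_sp (P : {poly F}) : (1 < size P)%N -> q <= v (sp P).
Proof.
move=> P1; rewrite nu_sp; last by rewrite -size_poly_gt0 (ltn_trans _ P1).
by rewrite -[leLHS]expr1 ler_eXn2l //; lia.
Qed.

(** [y] is the sequence of complete quotients. The size condition starts at index 1, since [b 0] is
    a polynomial part and may be any polynomial. *)
Definition cfrac b (y : nat -> ser F) :=
  forall n, y n = sp (b n) + (y n.+1)^-1 /\ 1 < v (y n.+1).

Lemma cfrac_shift b (y : nat -> ser F) k : cfrac b y ->
  cfrac (fun n => b (k + n)%N) (fun n => y (k + n)%N).
Proof. by move=> cf n; rewrite addnS; exact: cf. Qed.

(** * Sizes and errors of convergents *)

Section Convergents.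
Variables (b : nat -> {poly F}) (y : nat -> ser F).
Hypothesis cf : cfrac b y.

Local Notation P n := (sp (cnum b n)).
Local Notation Q n := (sp (cden b n)).

Lemma cfrac_gt1 n : 1 < v (y n.+1). Proof. by have [] := cf n. Qed.

Lemma cfrac_gt0 n : 0 < v (y n.+1). Proof. exact: lt_trans ltr01 (cfrac_gt1 n). Qed.

Lemma cfrac_neq0 n : y n.+1 != 0. Proof. by rewrite -(nu_gt0 R) cfrac_gt0. Qed.

Lemma cfracE n : y n = sp (b n) + (y n.+1)^-1. Proof. by have [] := cf n. Qed.

Lemma nu_cfrac_inv_lt1 n : v (y n.+1)^-1 < 1.
Proof. by rewrite nuV invf_lt1 ?cfrac_gt0 ?cfrac_gt1. Qed.

Lemma nu_quotient n : v (sp (b n.+1)) = v (y n.+1).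
Proof.
rewrite (_ : sp (b n.+1) = y n.+1 - (y n.+2)^-1); last by rewrite (cfracE n.+1) addrK.
by rewrite nuBl // (lt_trans (nu_cfrac_inv_lt1 _)) ?cfrac_gt1.
Qed.

Lemma size_quotient n : (1 < size (b n.+1))%N.
Proof. by rewrite -(nu_sp_gt1 R) nu_quotient cfrac_gt1. Qed.

Lemma cden_lt n : v (Q n) < v (Q n.+1).
Proof. by have [] := cden_growth size_quotient n. Qed.

Lemma nu_cdenSS n : v (Q n.+2) = v (sp (b n.+1)) * v (Q n.+1).
Proof. by have [] := cden_growth size_quotient n. Qed.

Lemma nu_cden_gt0 n : 0 < v (Q n.+1).
Proof. by apply: le_lt_trans _ (cden_lt n). Qed.

Lemma cden1 : Q 1 = 1. Proof. by rewrite /cden /= rmorph1. Qed.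
Lemma cden0 : Q 0 = 0. Proof. by rewrite /cden /= raddf0. Qed.
Lemma nu_cden_ge n : q ^+ n <= v (Q n.+1).
Proof.
elim: n => [|n IH]; first by rewrite cden1 nu1.
by rewrite nu_cdenSS exprS ler_pM ?exprn_ge0 ?q_le_nu_sp ?size_quotient.
Qed.

Lemma nu_cden_ge1 n : 1 <= v (Q n.+1).
Proof. by apply: le_trans _ (nu_cden_ge n); rewrite exprn_ege1 ?ltW. Qed.

(** The matrix of two consecutive convergents sends [y_(n+1)] to [y_0]. The relation is kept
    multiplied out, as are the homographies below. *)
Lemma cfrac_convergent n :
  y 0%N * (y n.+1 * Q n.+1 + Q n) = y n.+1 * P n.+1 + P n.
Proof.
elim: n => [|n IH].
  rewrite /cnum /cden /= raddf0 rmorph1 addr0 mulr1 (cfracE 0) mulrDl mulVf ?cfrac_neq0 //.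
  by rewrite [_ * y _]mulrC.
have /(congr1 (fun z => y n.+2 * z)) := IH.
rewrite {1 2}(cfracE n.+1) cnumSS cdenSS !rmorphD !rmorphM /=.
have y0 := cfrac_neq0 n.+1.
have -> : y n.+2 * (y 0%N * ((sp (b n.+1) + (y n.+2)^-1) * Q n.+1 + Q n)) =
  y 0%N * (y n.+2 * (sp (b n.+1) * Q n.+1 + Q n) + Q n.+1) by field.
by move=> ->; field.
Qed.

Lemma nu_complete_den z n : 1 < v z -> v (z * Q n.+1 + Q n) = v z * v (Q n.+1).
Proof.
move=> z1; rewrite nuDl nuM //; apply: lt_trans (cden_lt n) _.
by rewrite ltr_pMl ?nu_cden_gt0.
Qed.

Lemma sp_convergent_det n : P n.+1 * Q n - P n * Q n.+1 = (-1) ^+ n.+1.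
Proof. by rewrite -!rmorphM -rmorphB convergent_det rmorphXn rmorphN1. Qed.

Lemma nu_sign k : v ((-1) ^+ k : ser F) = 1.
Proof. by elim: k => [|k IH]; rewrite ?nu1 // exprS nuM IH nuN nu1 mulr1. Qed.

(** The error of index [n+1] times [y_(n+1) Q_(n+1) + Q_n], which has the size of [Q_(n+2)], is the
    determinant, that is, a sign. The formal convergent [1/0] is checked apart. *)
Lemma nu_convergent_error n : v (P n - y 0%N * Q n) = (v (Q n.+1))^-1.
Proof.
case: n => [|n]; first by rewrite /cnum /cden /= raddf0 rmorph1 mulr0 subr0 nu1 invr1.
have E : (P n.+1 - y 0%N * Q n.+1) * (y n.+1 * Q n.+1 + Q n) = (-1) ^+ n.+1.
  rewrite -sp_convergent_det mulrBl -mulrA [Q n.+1 * _]mulrC mulrA.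
  by rewrite cfrac_convergent; ring.
have := congr1 v E; rewrite nuM nu_sign nu_complete_den ?cfrac_gt1 //.
rewrite -nu_quotient -nu_cdenSS => E1.
by apply: (mulIf (x := v (Q n.+2))); rewrite ?E1 ?mulVf // gt_eqF ?nu_cden_gt0.
Qed.

(** If [B y_0 = A], then for large [n] the polynomial [B P_n - A Q_n] has absolute value below 1, so
    it is zero, whereas the error of a convergent never vanishes. *)
Lemma cfrac_irr : irr (y 0%N).
Proof.
move=> A B B0 AB.
have [n hn] := q_archi F (v (sp B)).
have E : sp (B * cnum b n - A * cden b n) = sp B * (P n - y 0%N * Q n).
  by rewrite rmorphB !rmorphM /= -AB; ring.
have lt1 : v (sp (B * cnum b n - A * cden b n)) < 1.
  rewrite E nuM nu_convergent_error ltr_pdivrMr ?nu_cden_gt0 // mul1r.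
  exact: lt_le_trans _ (nu_cden_ge n).
have := E; rewrite (nu_sp_lt1 lt1) raddf0 => /esym/eqP.
rewrite mulf_eq0 (sp_eq0 R) (negPf B0) /= -(nu_eq0 R) nu_convergent_error.
by rewrite invr_eq0 gt_eqF ?nu_cden_gt0.
Qed.

End Convergents.

Lemma cfrac_unique b (y z : nat -> ser F) : cfrac b y -> cfrac b z -> y 0%N = z 0%N.
Proof.
move=> cy cz; apply/eqP; rewrite -subr_eq0; apply/eqP.
apply: (@nu_arbitrarily_small F R) => k.
have Qk : 1 <= v (sp (cden b k.+1)) by exact: nu_cden_ge1 cy k.
have : v ((y 0%N - z 0%N) * sp (cden b k.+1)) <= (v (sp (cden b k.+2)))^-1.
  rewrite (_ : _ * _ = (sp (cnum b k.+1) - z 0%N * sp (cden b k.+1)) -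
                      (sp (cnum b k.+1) - y 0%N * sp (cden b k.+1))); last ring.
  by apply: nuB_le; rewrite (nu_convergent_error cy, nu_convergent_error cz).
rewrite nuM => h; apply: le_trans (_ : _ <= (v (sp (cden b k.+2)))^-1) _.
  by apply: le_trans _ h; rewrite ler_peMr.
rewrite lef_pV2 ?posrE ?exprn_gt0 ?(nu_cden_gt0 cy) //.
by apply: le_trans _ (nu_cden_ge cy k.+1); rewrite ler_eXn2l.
Qed.

Lemma irr_neq x (P : {poly F}) : irr x -> x - sp P != 0.
Proof.
move=> xi; rewrite subr_eq0; apply/eqP => xP.
by apply: (xi P 1); rewrite ?oner_neq0 // rmorph1 mul1r.
Qed.

Lemma irr_step x : irr x -> irr (x - sp (ser_floor x))^-1.
Proof.
move=> xi A B B0; have x0 := irr_neq (ser_floor x) xi.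
move/(congr1 (fun z => z * (x - sp (ser_floor x)))).
rewrite mulfVK // => E; have [A0|A0] := eqVneq A 0.
  by move/eqP: E; rewrite A0 raddf0 mul0r (sp_eq0 R) (negPf B0).
apply: (xi (B + A * ser_floor x) A A0).
by rewrite rmorphD rmorphM /= E; ring.
Qed.

Lemma irr_cfrac x : irr x -> exists b y, cfrac b y /\ y 0%N = x.
Proof.
move=> xi; pose y n := iter n (fun z => (z - sp (ser_floor z))^-1) x.
have yi n : irr (y n) by elim: n => // n; exact: irr_step.
exists (fun n => ser_floor (y n)), y; split=> // n; split.
  by rewrite /= invrK addrC subrK.
rewrite /= nuV invf_gt1 ?ser_floorP // nu_gt0; exact: irr_neq.
Qed.

Lemma nu_inv_diff (x y : ser F) : x != 0 -> y != 0 ->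
  v (x^-1 - y^-1) = v (x - y) / (v x * v y).
Proof.
move=> x0 y0; rewrite -!nuM -nuV -nuM nuBC; congr v.
by field; rewrite x0 y0.
Qed.

Lemma cfrac_exists b : (forall n, (1 < size (b n))%N) ->
  exists y, cfrac b y /\ 1 < v (y 0%N).
Proof.
move=> hb.
(* [u k n] is the finite fraction [[b_n; ..., b_(n+k)]]. At these sizes inversion divides distances
   by at least [q], so [u k n] converges as [k] grows, and the limits are the complete quotients. *)
pose fix u k n {struct k} := if k is k'.+1 then sp (b n) + (u k' n.+1)^-1 else sp (b n).
have b1 n : 1 < v (sp (b n)) by rewrite nu_sp_gt1.
have u1 k n : v (u k n) = v (sp (b n)).
  elim: k n => // k IH n /=; rewrite nuDl // nuV IH.
  by rewrite (lt_trans _ (b1 n)) // invf_lt1 ?(lt_trans ltr01).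
have u0 k n : u k n != 0 by rewrite -(nu_gt0 R) u1 (lt_trans ltr01).
have bq n : q <= v (sp (b n)).
  exact: q_le_nu_sp.
have inv_contract (x y : ser F) : 1 <= v x -> q <= v y -> x != 0 -> y != 0 ->
    v (x^-1 - y^-1) <= v (x - y) / q.
  move=> x1 yq x0 y0; rewrite nu_inv_diff // ler_wpM2l // lef_pV2 ?posrE //.
    by rewrite -[q]mul1r ler_pM // ltW.
  by rewrite mulr_gt0 // nu_gt0.
have uc n k : v (u k.+1 n - u k n) <= q ^- k.
  elim: k n => [|k IH] n.
    rewrite /= addrAC subrr add0r expr0 invr1 nuV ltW // invf_lt1 //.
    exact: lt_trans ltr01 _.
  rewrite (_ : u k.+2 n - u k.+1 n = (u k.+1 n.+1)^-1 - (u k n.+1)^-1); last first.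
    by rewrite /=; ring.
  apply: le_trans (inv_contract _ _ _ _ (u0 _ _) (u0 _ _)) _; rewrite ?u1 ?(ltW (b1 _)) //.
  by rewrite exprSr invfM ler_pM // invr_ge0 ltW.
have /choice[l lu] : forall n, exists l, forall k, v (l - u k n) <= q ^- k.
  by move=> n; apply: ser_nu_complete => k; exact: uc.
have l1 n : v (l n) = v (sp (b n)).
  rewrite -(u1 0 n) -(subrK (u 0 n) (l n)) nuDr // u1.
  apply: le_lt_trans (lu n 0%N) _; by rewrite expr0 invr1.
have l0 n : l n != 0 by rewrite -(nu_gt0 R) l1 (lt_trans ltr01).
exists l; split; last by rewrite l1.
move=> n; split; last by rewrite l1.
apply/eqP; rewrite -subr_eq0; apply/eqP; apply: (@nu_arbitrarily_small F R) => k.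
rewrite (_ : _ - _ = (l n - u k.+1 n) - ((l n.+1)^-1 - (u k n.+1)^-1)); last first.
  by rewrite /=; ring.
apply: nuB_le.
  apply: le_trans (lu n k.+1) _; rewrite lef_pV2 ?posrE ?exprn_gt0 //.
  by rewrite ler_eXn2l.
apply: le_trans (inv_contract _ _ _ _ (l0 _) (u0 _ _)) _; rewrite ?l1 ?u1 ?(ltW (b1 _)) //.
rewrite -[leRHS]mulr1 ler_pM ?lu ?invr_ge0 ?invf_le1 //.
by rewrite ltW.
Qed.

End ContinuedFractions.

(** * Conjugate pairs and homographies *)

Lemma homography_diff (K : fieldType) (a b c d x x' y y' : K) :
  c * x + d != 0 -> c * x' + d != 0 ->
  y * (c * x + d) = a * x + b -> y' * (c * x' + d) = a * x' + b ->
  y - y' = (a * d - b * c) * (x - x') / ((c * x + d) * (c * x' + d)).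
Proof.
move=> D0 D'0 E E'; apply: (mulIf (mulf_neq0 D0 D'0)).
rewrite mulfVK ?mulf_neq0 //.
transitivity (y * (c * x + d) * (c * x' + d) - y' * (c * x' + d) * (c * x + d)).
  by ring.
by rewrite E E'; ring.
Qed.

(** [(d s - b t, a t - c s)] is the adjugate matrix applied to [(s, t)]: moving the points by a
    homography amounts to moving the vector back. *)
Lemma homography_form (K : fieldType) (a b c d x x' y y' s t : K) :
  c * x + d != 0 -> c * x' + d != 0 ->
  y * (c * x + d) = a * x + b -> y' * (c * x' + d) = a * x' + b ->
  (s - y * t) * (s - y' * t) =
  ((d * s - b * t - x * (a * t - c * s)) * (d * s - b * t - x' * (a * t - c * s))) /
  ((c * x + d) * (c * x' + d)).
Proof.
move=> D0 D'0 E E'; apply: (mulIf (mulf_neq0 D0 D'0)).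
rewrite mulfVK ?mulf_neq0 //.
transitivity ((s * (c * x + d) - y * (c * x + d) * t) *
              (s * (c * x' + d) - y' * (c * x' + d) * t)); first by ring.
by rewrite E E'; ring.
Qed.

Section Homographies.
Variables (F : finFieldType) (R : realType).
Implicit Types (x y z : ser F) (a b c d : {poly F}).

Local Notation v := (nu R).
Local Notation q := (#|F|%:R : R).

(** Conjugacy in Vieta form: the relations are symmetric in the two points, which suits exchange and
    transport by homographies. *)
Definition qconj x x' := irr x /\ exists A B C : {poly F},
  [/\ A != 0, sp A * (x + x') = sp B & sp A * (x * x') = sp C].

Lemma irr_lin x a b : irr x -> sp a * x = sp b -> a = 0 /\ b = 0.
Proof.
move=> xi E; have [a0|a0] := eqVneq a 0; last by case: (xi b a a0).
by split=> //; apply/eqP; rewrite -(sp_eq0 R) -E a0 raddf0 mul0r.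
Qed.

Lemma hom_den_neq0 x a b c d : irr x -> a * d - b * c \is a GRing.unit ->
  sp c * x + sp d != 0.
Proof.
move=> xi u; apply/eqP => E; have [|c0 d0] := @irr_lin x c (- d) xi.
  by rewrite rmorphN; apply/eqP; rewrite -subr_eq0 opprK E.
by move: u; rewrite c0 -[d]opprK d0 oppr0 !mulr0 subr0 unitr0.
Qed.

Lemma qconj_irr x x' : qconj x x' -> irr x'.
Proof.
move=> [xi [A [B [C [A0 AB AC]]]]] P Q Q0 QP.
have AQ : A * Q != 0 by rewrite mulf_neq0.
apply: (xi (Q * B - A * P) (A * Q) AQ).
by rewrite rmorphB !rmorphM /= -AB -QP; ring.
Qed.

Lemma qconj_sym x x' : qconj x x' -> qconj x' x.
Proof.
move=> xx'; split; first exact: qconj_irr xx'.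
case: xx' => _ [A [B [C [A0 AB AC]]]].
by exists A, B, C; split=> //; rewrite (addrC, mulrC x').
Qed.

(** Cross-multiplying the two sets of relations leaves an equation linear in [x], which
    irrationality makes trivial; the two sums then agree. *)
Lemma qconj_unique x y z : qconj x y -> qconj x z -> y = z.
Proof.
move=> [xi [A [B [C [A0 AB AC]]]]] [_ [A' [B' [C' [A'0 AB' AC']]]]].
have E : sp (A' * B - A * B') * x = sp (A' * C - A * C').
  by rewrite !rmorphB !rmorphM /= -AB -AC -AB' -AC'; ring.
have [E1 _] := irr_lin xi E.
have AA : sp A * sp A' != 0 by rewrite mulf_neq0 ?(sp_eq0 R).
apply: (mulfI AA); apply: (addrI (sp A * sp A' * x)).
transitivity (sp (A' * B)); first by rewrite rmorphM /= -AB; ring.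
by rewrite (subr0_eq E1) rmorphM /= -AB'; ring.
Qed.

Lemma hom_irr x y a b c d : irr x -> a * d - b * c \is a GRing.unit ->
  y * (sp c * x + sp d) = sp a * x + sp b -> irr y.
Proof.
move=> xi u E P Q Q0 QP.
have E2 : sp (Q * a - P * c) * x = sp (P * d - Q * b).
  have : sp Q * (y * (sp c * x + sp d)) = sp Q * (sp a * x + sp b) by rewrite E.
  rewrite mulrA QP !rmorphB !rmorphM /= => E2; apply/eqP; rewrite -subr_eq0.
  move/eqP: E2; rewrite -subr_eq0 -oppr_eq0 => /eqP <-; apply/eqP; ring.
have [E3 E4] := irr_lin xi E2.
have : Q * (a * d - b * c) = 0.
  have -> : Q * (a * d - b * c) = (Q * a - P * c) * d + (P * d - Q * b) * c by ring.
  by rewrite E3 E4 !mul0r addr0.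
move/eqP; rewrite mulf_eq0 (negPf Q0) /= => /eqP u0.
by move: u; rewrite u0 unitr0.
Qed.

Lemma hom_qconj x x' y y' a b c d : qconj x x' -> a * d - b * c \is a GRing.unit ->
  y * (sp c * x + sp d) = sp a * x + sp b ->
  y' * (sp c * x' + sp d) = sp a * x' + sp b -> qconj y y'.
Proof.
move=> xx' u E E'; have x'i := qconj_irr xx'; case: xx' => xi.
case=> A [B [C [A0 AB AC]]]; split; first exact: hom_irr u E.
have D0 := hom_den_neq0 xi u; have D'0 := hom_den_neq0 x'i u.
(* The quadratic equation transformed by the homography. Its leading coefficient is
   [A (c x + d) (c x' + d)], nonzero by irrationality. *)
exists (c ^+ 2 * C + c * d * B + d ^+ 2 * A).
exists (2%:R * (a * c) * C + (a * d + b * c) * B + 2%:R * (b * d) * A).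
exists (a ^+ 2 * C + a * b * B + b ^+ 2 * A).
have AN : sp (c ^+ 2 * C + c * d * B + d ^+ 2 * A) =
    sp A * ((sp c * x + sp d) * (sp c * x' + sp d)).
  by rewrite !rmorphD !rmorphM /= ?rmorphXn /= -AB -AC; ring.
split.
- by rewrite -(sp_eq0 R) AN !mulf_neq0 ?(sp_eq0 R).
- rewrite AN; transitivity (sp A * ((y * (sp c * x + sp d)) * (sp c * x' + sp d) +
    (y' * (sp c * x' + sp d)) * (sp c * x + sp d))); first by ring.
  rewrite E E' !rmorphD !rmorphM /= !rmorphD !rmorphM /= ?rmorph_nat ?rmorph1 -AB -AC; ring.
- rewrite AN; transitivity (sp A * ((y * (sp c * x + sp d)) *
    (y' * (sp c * x' + sp d)))); first by ring.
  rewrite E E' !rmorphD !rmorphM /= ?rmorphXn /= -AB -AC; ring.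
Qed.

Definition qform x x' (u w : {poly F}) : R :=
  v ((sp u - x * sp w) * (sp u - x' * sp w)).

(** The unit determinant says that the two vectors form a basis of [F[Y]^2]; quantifying over all
    bases makes the property invariant under homographies. *)
Definition gap (m : nat) x x' := forall u w u2 w2 : {poly F},
  u * w2 - u2 * w \is a GRing.unit ->
  q ^- m * v (x - x') <= qform x x' u w /\
  q ^- m * v (x - x') ^+ 2 <= qform x x' u w * qform x x' u2 w2.

Lemma qformC x x' u w : qform x x' u w = qform x' x u w.
Proof. by rewrite /qform mulrC. Qed.

Lemma gap_sym m x x' : gap m x x' -> gap m x' x.
Proof. by move=> g u w u2 w2 /g; rewrite nuBC !(qformC x x'). Qed.

(** The adjugate substitution carries bases to bases, while [qform] and the distance between the
    points are divided by the same factor [|c x + d| |c x' + d|]. *)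
Lemma hom_gap m x x' y y' a b c d : irr x -> irr x' ->
  a * d - b * c \is a GRing.unit ->
  y * (sp c * x + sp d) = sp a * x + sp b ->
  y' * (sp c * x' + sp d) = sp a * x' + sp b ->
  gap m x x' -> gap m y y' /\ (x != x' -> y != y').
Proof.
move=> xi x'i u E E' g.
set D := sp c * x + sp d; set D' := sp c * x' + sp d.
have D0 : D != 0 := hom_den_neq0 xi u; have D'0 : D' != 0 := hom_den_neq0 x'i u.
have diff : y - y' = sp (a * d - b * c) * (x - x') / (D * D').
  by rewrite rmorphB !rmorphM; exact: homography_diff.
have vdiff : v (y - y') = v (x - x') / (v D * v D').
  by rewrite diff nuM nuV !nuM nu_sp_unit // mul1r.
have vD : 0 < v D * v D' by rewrite mulr_gt0 ?nu_gt0.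
have form s t : qform y y' s t =
    qform x x' (d * s - b * t) (a * t - c * s) / (v D * v D').
  rewrite /qform -!nuM -nuV -nuM; congr v.
  by rewrite !rmorphB !rmorphM; exact: homography_form.
split; last first.
  by move=> nx; rewrite -subr_eq0 -(nu_gt0 R) vdiff divr_gt0 // nu_gt0 subr_eq0.
move=> s t s2 t2 st.
have uu : (d * s - b * t) * (a * t2 - c * s2) - (d * s2 - b * t2) * (a * t - c * s)
    \is a GRing.unit.
  have -> : (d * s - b * t) * (a * t2 - c * s2) - (d * s2 - b * t2) * (a * t - c * s)
    = (a * d - b * c) * (s * t2 - s2 * t) by ring.
  by rewrite unitrM u st.
have [g1 g2] := g _ _ _ _ uu; rewrite !form vdiff; split.
  by rewrite mulrA ler_pM2r ?invr_gt0.
rewrite mulf_div expr_div_n mulrA ler_pM2r //.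
by rewrite invr_gt0 exprn_gt0.
Qed.

(** One matrix moves both points, so that a conjugate pair is followed as a pair. *)
Definition hom2 x x' y y' := exists a b c d : {poly F},
  [/\ a * d - b * c \is a GRing.unit,
      y * (sp c * x + sp d) = sp a * x + sp b &
      y' * (sp c * x' + sp d) = sp a * x' + sp b].

Lemma hom2_refl x x' : hom2 x x' x x'.
Proof.
exists 1, 0, 0, 1; rewrite rmorph1 raddf0 mulr1 mul0r subr0 unitr1.
by split; rewrite // mul0r add0r mulr1 mul1r addr0.
Qed.

Lemma hom2_trans y y' x x' z z' :
  hom2 x x' y y' -> hom2 y y' z z' -> hom2 x x' z z'.
Proof.
move=> [a [b [c [d [u E E']]]]] [a2 [b2 [c2 [d2 [u2 E2 E2']]]]].
exists (a2 * a + b2 * c), (a2 * b + b2 * d), (c2 * a + d2 * c), (c2 * b + d2 * d).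
split.
- have -> : (a2 * a + b2 * c) * (c2 * b + d2 * d) -
    (a2 * b + b2 * d) * (c2 * a + d2 * c) =
    (a2 * d2 - b2 * c2) * (a * d - b * c) by ring.
  by rewrite unitrM u u2.
- rewrite !rmorphD !rmorphM /=.
  transitivity (z * (sp c2 * y + sp d2) * (sp c * x + sp d)).
    transitivity (z * (sp c2 * (sp a * x + sp b) + sp d2 * (sp c * x + sp d))).
      by ring.
    by rewrite -E; ring.
  rewrite E2; transitivity (sp a2 * (y * (sp c * x + sp d)) +
    sp b2 * (sp c * x + sp d)); first by ring.
  by rewrite E; ring.
- rewrite !rmorphD !rmorphM /=.
  transitivity (z' * (sp c2 * y' + sp d2) * (sp c * x' + sp d)).
    transitivity (z' * (sp c2 * (sp a * x' + sp b) + sp d2 * (sp c * x' + sp d))).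
      by ring.
    by rewrite -E'; ring.
  rewrite E2'; transitivity (sp a2 * (y' * (sp c * x' + sp d)) +
    sp b2 * (sp c * x' + sp d)); first by ring.
  by rewrite E'; ring.
Qed.

End Homographies.

(** * The gap inequalities *)

Section Gap.
Variables (F : finFieldType) (R : realType).

Local Notation v := (nu R).
Local Notation q := (#|F|%:R : R).

Lemma qV_le1 (m : nat) : q ^- m <= 1.
Proof. by rewrite invf_le1 ?exprn_gt0 // exprn_ege1 // ltW. Qed.

Lemma qV_gt0 (m : nat) : 0 < q ^- m.
Proof. by rewrite invr_gt0 exprn_gt0. Qed.

Lemma convergent_unit (b : nat -> {poly F}) n :
  cnum b n.+1 * cden b n - cnum b n * cden b n.+1 \is a GRing.unit.
Proof. by rewrite convergent_det unitrX // unitrN1. Qed.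

(** If [x] were too close to [y 0], two consecutive convergents of [y 0], which form a basis, would
    give values of [qform] violating one of the two gap inequalities. *)
Lemma gap_far (m : nat) (x x' : ser F) b (y : nat -> ser F) :
  gap R m x x' -> x != x' -> cfrac R b y ->
  (forall n, q ^+ m < v (sp (b n.+1))) ->
  q ^- m * v (x - x') <= v (y 0%N - x).
Proof.
move=> g xx' cf big; rewrite leNgt; apply/negP.
set d := v (x - x'); set f := y 0%N; set r := v (f - x) => rd.
have d0 : 0 < d by rewrite nu_gt0 subr_eq0.
have rltd : r < d by apply: lt_le_trans rd _; rewrite ler_piMl ?qV_le1 // ltW.
have r0 : 0 <= r by [].
have fx' : v (f - x') = d.
  by rewrite -(subrK x f) -addrA nuDr.
(* The basis is chosen at the first crossing of [1/d] by [|Q_n| |Q_(n+1)|]. Thus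
   [W X d <= 1 < X Z d] below, which decides the dominant term in the estimates of [qform]. *)
have ex : exists n, 1 < v (sp (cden b n)) * v (sp (cden b n.+1)) * d.
  have [k hk] := q_archi F d^-1; exists k.+1.
  rewrite -ltr_pdivrMr // mul1r; apply: lt_le_trans hk _.
  apply: le_trans (nu_cden_ge cf k) _; rewrite ler_peMr //.
  exact: nu_cden_ge1 cf k.+1.
have [[|k] hk kmin] := ex_minnP ex.
  by move: hk; rewrite cden0 nu0 !mul0r ltr10.
have {}kmin : v (sp (cden b k)) * v (sp (cden b k.+1)) * d <= 1.
  by rewrite leNgt; apply/negP => /kmin; rewrite ltnn.
have W0 : 0 <= v (sp (cden b k)) by [].
have X0 := nu_cden_gt0 cf k; have Z0 := nu_cden_gt0 cf k.+1.
have ZX : q ^+ m * v (sp (cden b k.+1)) < v (sp (cden b k.+2)).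
  by rewrite (nu_cdenSS cf) ltr_pM2r.
have err n z : v (sp (cnum b n) - z * sp (cden b n)) <=
    Num.max (v (sp (cden b n.+1)))^-1 (v (f - z) * v (sp (cden b n))).
  rewrite -(nu_convergent_error cf) -nuM.
  rewrite (_ : _ - _ = (sp (cnum b n) - f * sp (cden b n)) + (f - z) * sp (cden b n));
    last ring.
  exact: nuD.
have [g1 g2] := g _ _ _ _ (convergent_unit b k).
set W := v (sp (cden b k)) in kmin W0 err *.
set X := v (sp (cden b k.+1)) in hk kmin X0 ZX err *.
set Z := v (sp (cden b k.+2)) in hk Z0 ZX err *.
have N1 : qform R x x' (cnum b k.+1) (cden b k.+1) <= Num.max Z^-1 (r * X) * (X * d).
  rewrite /qform nuM; apply: ler_pM => //.
  apply: le_trans (err k.+1 _) _; rewrite fx' mulrC ge_max lexx andbT.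
  by rewrite -[leLHS]mul1r ler_pdivrMr // mulrAC ltW.
have N2 : qform R x x' (cnum b k) (cden b k) <= X^-1 * X^-1.
  have small z : v (f - z) <= d -> v (sp (cnum b k) - z * sp (cden b k)) <= X^-1.
    move=> fz; apply: le_trans (err k _) _; rewrite ge_max lexx /=.
    rewrite -[leRHS]mul1r ler_pdivlMr // -/W; apply: le_trans kmin.
    by rewrite [leRHS]mulrC mulrA ler_pM2r // ler_wpM2r.
  by rewrite /qform nuM; apply: ler_pM; rewrite ?small ?fx' // ltW.
have g2' : q ^- m * d <= Num.max Z^-1 (r * X) / X.
  rewrite -(ler_pM2r d0) -mulrA -expr2; apply: le_trans g2 _.
  apply: le_trans (ler_pM _ _ N1 N2) _; try by rewrite /qform.
  by rewrite le_eqVlt; apply/orP; left; apply/eqP; field; rewrite gt_eqF.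
(* If the maximum is [r X], the product inequality gives [r >= q^-m d]. If it is [1/Z], the single
   inequality gives [Z <= q^m X], against the large partial quotient. *)
move: N1 g2'; rewrite maxEle; case: ifP => [_|/negbT]; last rewrite -ltNge => lt.
  by rewrite mulfK ?gt_eqF // => _; rewrite leNgt rd.
move=> N1 _; have := le_trans g1 N1.
rewrite -/d mulrA ler_pM2r // => h.
have : q ^+ m * X < q ^+ m * X; last by rewrite ltxx.
apply: lt_le_trans ZX _; move: h.
rewrite -(ler_pM2l Z0) mulrA mulfV ?gt_eqF // mul1r -/X ler_pdivrMr ?exprn_gt0 //.
by rewrite mulrC [_ * X]mulrC.
Qed.

(** * Gap inequalities for a purely periodic expansion *)

Section Periodic.
Variables (m k : nat) (b : nat -> {poly F}) (y : nat -> ser F) (x' : ser F).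
Hypothesis cf : cfrac R b y.
Hypothesis y0_gt1 : 1 < v (y 0%N).
Hypothesis period : y k.+1 = y 0%N.
Hypothesis x'_lt1 : v x' < 1.
Hypothesis x'_fix : x' * (x' * sp (cden b k.+1) + sp (cden b k)) =
  x' * sp (cnum b k.+1) + sp (cnum b k).
Hypothesis adjacent : forall n, v (sp (b n.+1)) * v (sp (b n.+2)) <= q ^+ m.

Local Notation P n := (sp (cnum b n)).
Local Notation Q n := (sp (cden b n)).
Local Notation x := (y 0%N).
Local Notation L u w := (sp u - x * sp w).
Local Notation L' u w := (sp u - x' * sp w).

Lemma nu_cnum n : v (P n.+1) = v x * v (Q n.+1).
Proof.
rewrite -(subrK (x * Q n.+1) (P n.+1)) nuDr nuM //.
rewrite (nu_convergent_error cf) (lt_le_trans (_ : _ < 1)) //.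
  rewrite invf_lt1 ?(nu_cden_gt0 cf) //.
  exact: le_lt_trans (nu_cden_ge1 cf n) (cden_lt cf _).
by rewrite -[1]mulr1 ler_pM // ?(nu_cden_ge1 cf) // ltW.
Qed.

Lemma cnum_lt n : v (P n) < v (P n.+1).
Proof.
case: n => [|n]; last by rewrite !nu_cnum ltr_pM2l ?(cden_lt cf) // (lt_trans ltr01).
by rewrite nu_cnum /cnum /cden /= rmorph1 nu1 mulr1.
Qed.

Lemma nu_conj_form n : v (P n - x' * Q n) = v (P n).
Proof.
case: n => [|n]; first by rewrite cden0 mulr0 subr0.
rewrite nuBl // nuM nu_cnum ltr_pM2r ?(nu_cden_gt0 cf) //.
exact: lt_trans y0_gt1.
Qed.

Lemma nu_diff_conj : v (x - x') = v x.
Proof. by rewrite nuBl // (lt_trans x'_lt1). Qed.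

(** The error [1/|Q_(n+2)|] is multiplied by [|P_(n+1)| = |x| |Q_(n+1)|]. The form at a convergent
    thus reads off the degree of the next partial quotient, which turns [adjacent] into a gap
    inequality. *)
Lemma qform_convergent n :
  qform R x x' (cnum b n.+1) (cden b n.+1) = v x / v (sp (b n.+1)).
Proof.
rewrite /qform nuM (nu_convergent_error cf) nu_conj_form nu_cnum (nu_cdenSS cf).
have Q0 := nu_cden_gt0 cf n; have := cfrac_gt0 cf n; rewrite -(nu_quotient cf) => b0.
by field; rewrite !gt_eqF.
Qed.

Lemma form_neq0 (u w u2 w2 : {poly F}) : u * w2 - u2 * w \is a GRing.unit -> L u w != 0.
Proof.
move=> un; apply/eqP => /subr0_eq/esym E.
have [w0 u0] := irr_lin R (cfrac_irr cf) (etrans (mulrC _ _) E).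
by move: un; rewrite w0 u0 mul0r mulr0 subr0 unitr0.
Qed.

(* Legendre's criterion: in the basis of two consecutive convergents, a vector on
   which [L] is small and whose second coordinate is nonzero has a first
   coordinate so large that [qform] is at least [v x]. *)
Lemma small_form_convergent (u w u2 w2 : {poly F}) :
  u * w2 - u2 * w \is a GRing.unit -> v (L u w) < 1 ->
  v x <= qform R x x' u w \/
  exists n (s : {poly F}), [/\ s \is a GRing.unit, u = s * cnum b n.+1 &
    w = s * cden b n.+1].
Proof.
move=> un L1.
have L0 : 0 < v (L u w) by rewrite nu_gt0 (form_neq0 un).
have ex : exists n, (v (Q n.+1))^-1 <= v (L u w).
  have [n hn] := q_archi F (v (L u w))^-1; exists n.
  rewrite invf_ple ?posrE ?(nu_cden_gt0 cf) //; apply: ltW.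
  exact: lt_le_trans hn (nu_cden_ge cf n).
have [[|j] hj jmin] := ex_minnP ex.
  by move: hj; rewrite cden1 nu1 invr1 leNgt L1.
have {}jmin : v (L u w) < (v (Q j.+1))^-1.
  by rewrite ltNge; apply/negP => /jmin; rewrite ltnn.
(* [s] and [t] are the coordinates of [(u, w)] in the basis of convergents; the determinant [e] is a
   sign, hence its own inverse. *)
pose e : {poly F} := (-1) ^+ j.+1.
pose s := e * (u * cden b j - w * cnum b j).
pose t := e * (cnum b j.+1 * w - cden b j.+1 * u).
have ee : e * e = 1 by rewrite /e -expr2 -exprM mulnC exprM sqrrN !expr1n.
have eE : e = cnum b j.+1 * cden b j - cnum b j * cden b j.+1.
  by rewrite convergent_det.
have uE : u = s * cnum b j.+1 + t * cnum b j.
  by rewrite -[LHS]mul1r -ee {2}eE /s /t; ring.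
have wE : w = s * cden b j.+1 + t * cden b j.
  by rewrite -[LHS]mul1r -ee {2}eE /s /t; ring.
have [t0|t0] := eqVneq t 0.
  right; exists j, s; move: uE wE; rewrite t0 !mul0r !addr0 => uE wE.
  split=> //; move: un; rewrite uE wE.
  have -> : s * cnum b j.+1 * w2 - u2 * (s * cden b j.+1) =
    s * (cnum b j.+1 * w2 - u2 * cden b j.+1) by ring.
  by rewrite unitrM => /andP[].
left.
have t1 := nu_sp_ge1 R t0.
have LE : L u w = sp s * (P j.+1 - x * Q j.+1) + sp t * (P j - x * Q j).
  by rewrite uE wE !rmorphD !rmorphM /=; ring.
have L'E : L' u w = sp s * (P j.+1 - x' * Q j.+1) + sp t * (P j - x' * Q j).
  by rewrite uE wE !rmorphD !rmorphM /=; ring.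
have X0 := nu_cden_gt0 cf j; have Z0 := nu_cden_gt0 cf j.+1.
(* [L u w] is smaller than its term in [t], so its two terms have equal size. This forces
   [|s| > |t|], and in the conjugate form the term in [s] then dominates. *)
have st : v (sp s) / v (Q j.+2) = v (sp t) / v (Q j.+1).
  have E : v (sp s * (P j.+1 - x * Q j.+1)) = v (sp t * (P j - x * Q j)).
    rewrite (_ : sp s * _ = L u w - sp t * (P j - x * Q j)); last by rewrite LE addrK.
    rewrite nuBr // nuM (nu_convergent_error cf); apply: lt_le_trans jmin _.
    by rewrite ler_peMl // invr_ge0.
  by move: E; rewrite !nuM !(nu_convergent_error cf).
have sE : v (sp s) = v (sp t) / v (Q j.+1) * v (Q j.+2).
  by rewrite -st mulfVK ?gt_eqF.
have ts : v (sp t) < v (sp s).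
  rewrite sE mulrAC ltr_pdivlMr // ltr_pM2l ?(cden_lt cf) //.
  exact: lt_le_trans ltr01 t1.
have vL' : v (L' u w) = v (sp s) * v (P j.+1).
  rewrite L'E nuDl nuM nu_conj_form // nuM nu_conj_form.
  by apply: ltr_pM => //; exact: cnum_lt.
rewrite /qform nuM vL' nu_cnum.
apply: le_trans (_ : (v (Q j.+2))^-1 * (v (sp s) * (v x * v (Q j.+1))) <= _).
  rewrite sE [leRHS](_ : _ = v (sp t) * v x); first by rewrite ler_peMl.
  by field; rewrite !gt_eqF.
have s0 : 0 < v (sp s) by exact: le_lt_trans ts.
by rewrite ler_pM2r // !mulr_gt0 // (lt_trans ltr01).
Qed.

Lemma cden_mono i j : (i < j)%N -> v (Q i) < v (Q j).
Proof.
elim: j => // j IH; rewrite ltnS leq_eqVlt => /orP[/eqP ->|/IH h]; first exact: cden_lt.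
exact: lt_trans h (cden_lt cf j).
Qed.

(** Rewritten through the errors, the determinant has the size of [Q_j / Q_(i+1)]. Consequently two
    convergents that form a basis are consecutive. *)
Lemma far_convergents_det i j : (i.+1 < j)%N -> 1 < v (P i * Q j - P j * Q i).
Proof.
move=> ij; have Qj0 : 0 < v (Q j) by rewrite (le_lt_trans _ (cden_mono ij)).
rewrite (_ : _ - _ = (P i - x * Q i) * Q j - (P j - x * Q j) * Q i); last ring.
have A1 : 1 < v ((P i - x * Q i) * Q j).
  rewrite nuM (nu_convergent_error cf) mulrC ltr_pdivlMr ?(nu_cden_gt0 cf) // mul1r.
  exact: cden_mono.
rewrite nuBl //; apply: lt_trans A1.
rewrite nuM (nu_convergent_error cf) mulrC ltr_pdivrMr ?(nu_cden_gt0 cf) // mul1r.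
by apply: cden_mono; lia.
Qed.

Lemma quotient_ge1 n : 1 <= v (sp (b n.+1)).
Proof. by rewrite (nu_quotient cf) ltW // (cfrac_gt1 cf). Qed.

Lemma quotient_le n : v (sp (b n.+1)) <= q ^+ m.
Proof. by apply: le_trans (adjacent n); rewrite ler_peMr // quotient_ge1. Qed.

Lemma qform_scale s u w : s \is a GRing.unit ->
  qform R x x' (s * u) (s * w) = qform R x x' u w.
Proof.
move=> su; rewrite /qform !rmorphM /=.
rewrite (_ : _ * _ = sp s * sp s * (L u w * L' u w)); last ring.
by rewrite nuM nuM nu_sp_unit // !mul1r.
Qed.

Lemma adjacent_qforms i : q ^- m * v x ^+ 2 <=
  qform R x x' (cnum b i.+1) (cden b i.+1) * qform R x x' (cnum b i.+2) (cden b i.+2).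
Proof.
rewrite !qform_convergent mulf_div -expr2 mulrC ler_pM2l ?exprn_gt0 ?(lt_trans ltr01) //.
rewrite lef_pV2 ?posrE ?exprn_gt0 // mulr_gt0 // (lt_le_trans ltr01) ?quotient_ge1 //.
Qed.

(** By [small_form_convergent] each vector either has [qform] at least [|x|], and then the single
    bound on the other suffices, or is a convergent up to a unit. Two convergents forming a basis
    are consecutive, and [adjacent] concludes. *)
Lemma gap_contracted (u w u2 w2 : {poly F}) : u * w2 - u2 * w \is a GRing.unit ->
  v (L u w) < 1 -> v (L u2 w2) < 1 ->
  q ^- m * v x <= qform R x x' u w /\
  q ^- m * v x ^+ 2 <= qform R x x' u w * qform R x x' u2 w2.
Proof.
move=> un L1 L2.
have x0 : 0 < v x by exact: lt_trans ltr01 _.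
have un2 : u2 * w - u * w2 \is a GRing.unit by rewrite -opprB unitrN.
have single n : q ^- m * v x <= v x / v (sp (b n.+1)).
  rewrite mulrC ler_pM2l // lef_pV2 ?posrE ?exprn_gt0 ?quotient_le //.
  exact: lt_le_trans ltr01 (quotient_ge1 n).
have one (s t s2 t2 : {poly F}) : s * t2 - s2 * t \is a GRing.unit ->
    v (L s t) < 1 -> q ^- m * v x <= qform R x x' s t.
  move=> st /(small_form_convergent st)[h|[n [c [cu -> ->]]]].
    by apply: le_trans h; rewrite ler_piMl ?qV_le1.
  by rewrite qform_scale // qform_convergent.
have both (s t s2 t2 : {poly F}) : v x <= qform R x x' s t ->
    q ^- m * v x <= qform R x x' s2 t2 ->
    q ^- m * v x ^+ 2 <= qform R x x' s t * qform R x x' s2 t2.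
  move=> h h2; rewrite mulrC expr2 -mulrA [v x * q ^- m]mulrC.
  by apply: ler_pM => //; rewrite mulr_ge0 // ltW ?qV_gt0.
split; first exact: one un L1.
have [h|[i [c [cu uE wE]]]] := small_form_convergent un L1.
  by apply: both => //; exact: one un2 L2.
have [h|[j [d [du u2E w2E]]]] := small_form_convergent un2 L2.
  by rewrite [leRHS]mulrC; apply: both => //; exact: one un L1.
rewrite uE wE u2E w2E !qform_scale //.
have cd : v (P i.+1 * Q j.+1 - P j.+1 * Q i.+1) = 1.
  rewrite -!rmorphM -rmorphB nu_sp_unit //; move: un; rewrite uE wE u2E w2E.
  rewrite (_ : _ - _ = (c * d) * (cnum b i.+1 * cden b j.+1 -
    cnum b j.+1 * cden b i.+1)); last ring.
  by rewrite unitrM => /andP[].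
have [ij|ji|ij] := ltngtP i j.
- have [<-|ne] := eqVneq i.+1 j; first exact: adjacent_qforms.
  have /far_convergents_det : (i.+2 < j.+1)%N by lia.
  by rewrite cd ltxx.
- have [<-|ne] := eqVneq j.+1 i; first by rewrite [leRHS]mulrC; exact: adjacent_qforms.
  have /far_convergents_det : (j.+2 < i.+1)%N by lia.
  by rewrite nuBC cd ltxx.
- by move: cd; rewrite ij subrr nu0 => /eqP; rewrite eq_sym oner_eq0.
Qed.

(** The row [(1, -z)] is a left eigenvector of the period matrix as soon as [z] is a fixed point,
    with eigenvalue [P_(k+1) - z Q_(k+1)]. *)
Lemma fixed_form z (u w : {poly F}) :
  z * (z * Q k.+1 + Q k) = z * P k.+1 + P k ->
  sp (cnum b k.+1 * u + cnum b k * w) - z * sp (cden b k.+1 * u + cden b k * w) =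
  (P k.+1 - z * Q k.+1) * (sp u - z * sp w).
Proof.
move=> E; rewrite !rmorphD !rmorphM /=.
have -> : P k = z * (z * Q k.+1 + Q k) - z * P k.+1 by rewrite E addrC addKr.
ring.
Qed.

(* The period matrix fixes both roots, preserves [qform] and contracts [L], so
   any basis can be moved into the region where [gap_contracted] applies. *)
Lemma periodic_gap : gap R m x x'.
Proof.
rewrite /gap nu_diff_conj.
have xfix : x * (x * Q k.+1 + Q k) = x * P k.+1 + P k.
  by rewrite -{2 3}period; exact: cfrac_convergent cf k.
have main N : forall u w u2 w2 : {poly F}, u * w2 - u2 * w \is a GRing.unit ->
    v (L u w) < q ^+ N -> v (L u2 w2) < q ^+ N ->
    q ^- m * v x <= qform R x x' u w /\
    q ^- m * v x ^+ 2 <= qform R x x' u w * qform R x x' u2 w2.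
  elim: N => [|N IH] u w u2 w2 un L1 L2; first exact: gap_contracted.
  have vl : v (P k.+1 - x * Q k.+1) <= q^-1.
    rewrite (nu_convergent_error cf) lef_pV2 ?posrE ?(nu_cden_gt0 cf) //.
    apply: le_trans (nu_cden_ge cf k.+1); rewrite -[leLHS]expr1 ler_eXn2l //.
  (* The two eigenvalues have sizes [1/|Q_(k+2)|] and [|x| |Q_(k+1)|], which are inverse to each
     other because [y_(k+1) = x]. *)
  have norm1 : v ((P k.+1 - x * Q k.+1) * (P k.+1 - x' * Q k.+1)) = 1.
    rewrite nuM (nu_convergent_error cf) nu_conj_form nu_cnum (nu_cdenSS cf).
    rewrite (nu_quotient cf) period mulVf // gt_eqF // mulr_gt0 ?(nu_cden_gt0 cf) //.
    exact: lt_trans ltr01 _.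
  have shrink s t : v (L s t) < q ^+ N.+1 ->
      v (L (cnum b k.+1 * s + cnum b k * t) (cden b k.+1 * s + cden b k * t)) < q ^+ N.
    move=> h; rewrite fixed_form // nuM.
    apply: le_lt_trans (_ : _ <= q^-1 * v (L s t)) _; first by rewrite ler_wpM2r.
    by rewrite mulrC ltr_pdivrMr // -exprSr.
  have invar s t : qform R x x' (cnum b k.+1 * s + cnum b k * t)
      (cden b k.+1 * s + cden b k * t) = qform R x x' s t.
    rewrite /qform (fixed_form _ _ xfix) (fixed_form _ _ x'_fix) [in LHS]mulrACA.
    by rewrite [LHS]nuM norm1 mul1r.
  rewrite -(invar u w) -(invar u2 w2); apply: IH; try exact: shrink.
  rewrite (_ : _ - _ = (cnum b k.+1 * cden b k - cnum b k * cden b k.+1) *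
    (u * w2 - u2 * w)); last ring.
  by rewrite unitrM convergent_unit.
move=> u w u2 w2 un.
have [n1 h1] := q_archi F (v (L u w)); have [n2 h2] := q_archi F (v (L u2 w2)).
apply: (main (maxn n1 n2)) => //.
  by apply: lt_le_trans h1 _; rewrite ler_eXn2l // leq_maxl.
by apply: lt_le_trans h2 _; rewrite ler_eXn2l // leq_maxr.
Qed.

End Periodic.
End Gap.

(** * A universal periodic continued fraction *)

Section Words.
Variable F : finFieldType.
Implicit Types (p : {poly F}) (w : seq {poly F}) (m : nat).

Definition adj m p p' := ((size p).-1 + (size p').-1 <= m)%N.

(** Row vectors of length [m] enumerate the polynomials of size at most [m]; the filter leaves the
    degrees from 1 to [m - 1]. *)
Definition letters m : seq {poly F} :=
  [seq p : {poly F} <- [seq rVpoly r | r <- enum {: 'rV[F]_m}] | (1 < size p)%N].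

Lemma mem_letters m p : (p \in letters m) = (1 < size p <= m)%N.
Proof.
rewrite mem_filter; congr (_ && _); apply/mapP/idP => [[r _ ->]|pm].
  exact: size_poly.
by exists (poly_rV p); rewrite ?mem_enum // poly_rV_K.
Qed.

(** The empty word is added at every level, so all lengths up to [r] occur. *)
Fixpoint words m r : seq (seq {poly F}) :=
  if r is r'.+1 then
    [::] :: [seq p :: w | p <- letters m, w <- words m r']
  else [:: [::]].

Lemma nil_words m r : [::] \in words m r.
Proof. by case: r => [|r] /=; rewrite in_cons eqxx. Qed.

Lemma cons_words m r p w :
  p \in letters m -> w \in words m r -> p :: w \in words m r.+1.
Proof.
by move=> pl wr; rewrite /= in_cons; apply/orP; right; apply/allpairsP; exists (p, w).
Qed.

Lemma words_letters m r w : w \in words m r -> {subset w <= letters m}.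
Proof.
elim: r w => [|r IH] w /=; rewrite in_cons; first by rewrite orbF => /eqP ->.
case/orP => [/eqP -> //|/allpairsP[[p w'] /= [pl wr ->]]] p'.
by rewrite in_cons => /orP[/eqP -> //|]; exact: IH.
Qed.

(* Two prefixes are offered so that one of them differs from any given partial
   quotient; see [orbit_approximation]. *)
Definition blocks m : seq (seq {poly F}) :=
  [seq s <- [seq p :: w | p <- [:: 'X; 'X + 1], w <- words m m] | sorted (adj m) s].

Definition period_word m := flatten (blocks m).

Definition universal_quotient m n : {poly F} :=
  nth 'X (period_word m) (n %% size (period_word m)).

Lemma blocksP m s : (1 < m)%N -> s \in blocks m ->
  exists p w, [/\ s = p :: w, size p = 2%N, path (adj m) p w &
    {subset p :: w <= letters m}].
Proof.
move=> m1; rewrite mem_filter => /andP[ss /allpairsP[[p w] /= [pX wr sE]]].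
exists p, w; move: ss; rewrite sE /= => ss.
have p2 : size p = 2%N.
  by move: pX; rewrite !inE => /orP[/eqP ->|/eqP ->]; rewrite ?size_polyX ?size_XaddC.
split=> // p'; rewrite in_cons => /orP[/eqP ->|]; last exact: words_letters wr _.
by rewrite mem_letters p2.
Qed.

Lemma mem_blocks m p w : p \in [:: 'X; 'X + 1] -> w \in words m m ->
  path (adj m) p w -> p :: w \in blocks m.
Proof.
move=> pX wr pw; rewrite mem_filter; apply/andP; split=> //.
by apply/allpairsP; exists (p, w).
Qed.

Lemma adj_deg1 m p p' : (size p <= m)%N -> size p' = 2%N -> (1 < m)%N -> adj m p p'.
Proof. rewrite /adj => pm -> m1; case: (size p) pm => /=; lia. Qed.

(** Junctions between blocks are harmless: a block begins with a letter of degree 1, and every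
    letter has degree at most [m - 1]. *)
Lemma flatten_path m (ss : seq (seq {poly F})) p0 : (1 < m)%N ->
  {subset ss <= blocks m} -> (size p0 <= m)%N -> path (adj m) p0 (flatten ss).
Proof.
move=> m1; elim: ss p0 => //= s ss IH p0 sub p0m.
have [p [w [-> p2 pw pl]]] := blocksP m1 (sub s (mem_head _ _)).
rewrite cat_path /= pw adj_deg1 //=; apply: IH.
  by move=> s' s'ss; apply: sub; rewrite in_cons s'ss orbT.
by have := pl _ (mem_last p w); rewrite mem_letters => /andP[].
Qed.

Lemma period_word_letters m : (1 < m)%N -> {subset period_word m <= letters m}.
Proof.
move=> m1 p /flattenP[s /(blocksP m1)[p' [w [-> _ _ pl]]]]; exact: pl.
Qed.

Lemma flatten_split (T : eqType) (ss : seq (seq T)) s : s \in ss ->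
  exists s1 s2, flatten ss = s1 ++ s ++ s2.
Proof.
elim: ss => //= s' ss IH; rewrite in_cons => /orP[/eqP ->|/IH[s1 [s2 ->]]].
  by exists [::], (flatten ss).
by exists (s' ++ s1), s2; rewrite -!catA.
Qed.

Lemma block_occurs m s : s \in blocks m ->
  exists i, forall j, (j < size s)%N -> universal_quotient m (i + j) = nth 'X s j.
Proof.
move=> /flatten_split[s1 [s2 E]]; exists (size s1) => j js.
rewrite /universal_quotient /period_word E modn_small; last by rewrite !size_cat ltn_add2l ltn_addr.
rewrite nth_cat ltnNge leq_addr /= addnC addnK nth_cat js //.
Qed.

Lemma period_word_gt0 m : (0 < size (period_word m))%N.
Proof.
have /flatten_split[s1 [s2]] : [:: 'X] \in blocks m.
  by apply: mem_blocks => //; [exact: mem_head|exact: nil_words].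
by rewrite /period_word => ->; rewrite !size_cat addnCA.
Qed.

Lemma universal_quotientP m n : (1 < m)%N -> (1 < size (universal_quotient m n) <= m)%N.
Proof.
move=> m1; rewrite -mem_letters; apply: period_word_letters => //.
by rewrite mem_nth // ltn_mod period_word_gt0.
Qed.

Lemma universal_quotient_adj m n : (1 < m)%N ->
  adj m (universal_quotient m n) (universal_quotient m n.+1).
Proof.
move=> m1; have K0 := period_word_gt0 m.
have /andP[_ nm] := universal_quotientP n m1.
(* The preceding letter [p0] is arbitrary, so it can be the current quotient: its first step covers
   the return from the end of the period to its beginning. *)
have pathB p0 : (size p0 <= m)%N -> path (adj m) p0 (period_word m).
  by apply: flatten_path.
rewrite {2}/universal_quotient modnS; case: ifPn => [_|dvd].
  exact: (pathP 'X (pathB _ nm)).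
have lt : ((n %% size (period_word m)).+1 < size (period_word m))%N.
  by have := ltn_pmod n.+1 K0; rewrite modnS (negPf dvd).
exact: (pathP 'X (pathB _ nm) _ lt).
Qed.

Lemma universal_quotient_period m n :
  universal_quotient m (size (period_word m) + n) = universal_quotient m n.
Proof. by rewrite /universal_quotient modnDl. Qed.

End Words.

(** * Density of the words, tails of the expansion and their conjugates *)

Section Universal.
Variables (F : finFieldType) (R : realType) (m : nat).
Hypothesis m_gt1 : (1 < m)%N.

Local Notation v := (nu R).
Local Notation q := (#|F|%:R : R).

Fixpoint starts (w : seq {poly F}) (x : ser F) : Prop :=
  1 < v x /\ if w is p :: w' then exists z, x = sp p + z^-1 /\ starts w' z else True.

Lemma starts_gt1 w x : starts w x -> 1 < v x.
Proof. by case: w => [|p w] /= []. Qed.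

Lemma nu_sp_deg (p : {poly F}) : (1 < size p)%N -> v (sp p) = q ^+ (size p).-1.
Proof. by move=> p1; rewrite nu_sp // -size_poly_gt0 (ltn_trans _ p1). Qed.

Lemma nu_starts (p : {poly F}) w x : (1 < size p)%N -> starts (p :: w) x -> v x = q ^+ (size p).-1.
Proof.
move=> p1 [_ [z [-> /starts_gt1 z1]]]; rewrite -nu_sp_deg // nuDl //.
apply: lt_trans (_ : _ < 1) _; last by rewrite nu_sp_gt1.
by rewrite nuV invf_lt1 ?(lt_trans ltr01).
Qed.

Lemma lerqV (i j : nat) : (q ^- i <= q ^- j) = (j <= i)%N.
Proof. by rewrite lef_pV2 ?posrE ?exprn_gt0 // ler_eXn2l. Qed.

(** Partial quotients are copied while their degree stays below the budget [m - deg p] left by the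
    preceding letter [p]; the first that reaches it is replaced by a power of [Y]. The length bound
    [r] also caps the precision, to let the induction start from the trivial bound 1. *)
Lemma words_dense b (y : nat -> ser F) : cfrac R b y ->
  forall r n (p : {poly F}), (1 < size p <= m)%N ->
  exists w, [/\ w \in words F m r, path (adj m) p w &
    forall x, starts w x ->
      v (x^-1 - (y n.+1)^-1) <= q ^- (minn (m - (size p).-1) r)].
Proof.
move=> cf; elim=> [|r IH] n p /andP[p1 pm].
  exists [::]; split=> [||x /starts_gt1 x1] //.
  rewrite minn0 expr0 invr1; apply: nuB_le; last exact: ltW (nu_cfrac_inv_lt1 cf n).
  by rewrite nuV ltW // invf_lt1 // (lt_trans ltr01).
have sizeSS (p' : {poly F}) : (1 < size p')%N -> exists s, size p' = s.+2.
  by case: (size p') => [|[|s]] // _; exists s.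
have b1 := size_quotient cf n.
have vy : v (y n.+1) = q ^+ (size (b n.+1)).-1 by rewrite -(nu_quotient cf) nu_sp_deg.
have [s sE] := sizeSS _ p1; have [t tE] := sizeSS _ b1.
rewrite sE /= in pm *; rewrite tE /= in vy.
(* When the next quotient reaches the budget, a power of [Y] of exactly that degree makes both
   inverses at most [q^-(m - deg p)]. *)
have [big|small] := leqP (m - s.+1) t.+1.
  have sX : size ('X^(m - s.+1) : {poly F}) = (m - s.+1).+1 by rewrite size_polyXn.
  exists [:: 'X^(m - s.+1)]; split.
  - apply: cons_words; last exact: nil_words.
    by rewrite mem_letters sX; lia.
  - by rewrite /= andbT /adj sX sE /=; lia.
  - move=> x xs; have vx := nu_starts _ xs; rewrite sX in vx.
    by apply: nuB_le; rewrite nuV ?vy ?vx ?lerqV /=; lia.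
(* Below the budget the quotient is copied; inversion divides the remaining distance by
   [q^(2 deg b_(n+1))], more than enough for the change of budget. *)
have bm : (1 < size (b n.+1) <= m)%N by rewrite tE; lia.
have [w [wr bw close]] := IH n.+1 _ bm.
exists (b n.+1 :: w); split.
- by apply: cons_words => //; rewrite mem_letters.
- by rewrite /= bw andbT /adj sE tE /=; lia.
move=> x xs; have vx := nu_starts b1 xs; rewrite tE /= in vx close.
case: xs => x1 [z [xE zs]].
have x0 : x != 0 by rewrite -(nu_gt0 R) (lt_trans ltr01).
rewrite nu_inv_diff ?(cfrac_neq0 cf) // vx vy -exprD.
have -> : x - y n.+1 = z^-1 - (y n.+2)^-1 by rewrite xE (cfracE cf n.+1); ring.
apply: le_trans (_ : _ <= q ^- (minn (m - t.+1) r) / q ^+ (t.+1 + t.+1)) _.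
  by rewrite ler_wpM2r ?close // invr_ge0 exprn_ge0.
by rewrite -invfM -exprD lerqV; lia.
Qed.

Lemma starts_cfrac b (y : nat -> ser F) w i : cfrac R b y ->
  (forall j, (j < size w)%N -> b (i.+1 + j)%N = nth 'X w j) -> starts w (y i.+1).
Proof.
move=> cf; elim: w i => [|p w IH] i bw; split; rewrite ?(cfrac_gt1 cf) //.
exists (y i.+2); split; last by apply: IH => j jw; rewrite addSnnS; exact: bw.
by rewrite {1}(cfracE cf i.+1) -[i.+1]addn0 bw.
Qed.

(** The image of [x'] under the homography that carries [y_0] to [y_n], hence the conjugate of the
    tail [y_n]. *)
Fixpoint conj_tail (b : nat -> {poly F}) (x' : ser F) n :=
  if n is n'.+1 then (conj_tail b x' n' - sp (b n'))^-1 else x'.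

Lemma conj_tail_lt1 (b : nat -> {poly F}) x' : (forall n, (1 < size (b n))%N) -> v x' < 1 ->
  forall n, v (conj_tail b x' n) < 1.
Proof.
move=> hb x'1; elim=> //= n IH.
have b1 : 1 < v (sp (b n)) by rewrite nu_sp_gt1.
rewrite nuV nuBr; last exact: lt_trans b1.
by rewrite invf_lt1 // (lt_trans ltr01).
Qed.

Lemma tail_hom2 b (y : nat -> ser F) x' : cfrac R b y ->
  (forall n, (1 < size (b n))%N) -> v x' < 1 ->
  forall n, hom2 (y 0%N) x' (y n) (conj_tail b x' n).
Proof.
move=> cf hb x'1; elim=> [|n IH]; first exact: hom2_refl.
apply: hom2_trans IH _; exists 0, 1, 1, (- b n); split.
- by rewrite mul0r sub0r mulr1 unitrN1.
- rewrite rmorph1 rmorphN raddf0 mul1r mul0r add0r.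
  have -> : y n - sp (b n) = (y n.+1)^-1 by rewrite {1}(cfracE cf n) addrC addKr.
  by rewrite mulfV ?(cfrac_neq0 cf).
rewrite rmorph1 rmorphN raddf0 mul1r mul0r add0r /= mulVf //.
rewrite -(nu_gt0 R) nuBr.
  by rewrite (lt_trans ltr01) // nu_sp_gt1.
by apply: lt_trans (conj_tail_lt1 hb x'1 n) _; rewrite nu_sp_gt1.
Qed.

Lemma universal_exists : exists (b : nat -> {poly F}) (y : nat -> ser F) (x' : ser F),
  [/\ cfrac R b y, (forall n, (1 < size (b n))%N), v x' < 1 /\ 1 < v (y 0%N),
      qconj (y 0%N) x' /\ gap R m (y 0%N) x' &
      forall p w, p \in [:: 'X; 'X + 1] -> w \in words F m m -> path (adj m) p w ->
        exists i, b i = p /\ starts w (y i.+1)].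
Proof.
pose b := universal_quotient F m.
have hb n : (1 < size (b n))%N by case/andP: (universal_quotientP F n m_gt1).
have [y [cf y1]] := cfrac_exists R hb.
have [k kE] : exists k, size (period_word F m) = k.+1.
  by exists (size (period_word F m)).-1; rewrite prednK // period_word_gt0.
have per : y k.+1 = y 0%N.
  rewrite -[in LHS](addn0 k.+1); apply/esym.
  apply: (cfrac_unique (b := b) (z := fun n => y (k.+1 + n)%N) cf).
  have := cfrac_shift k.+1 cf; congr cfrac; apply/funext => n.
  by rewrite -kE /b universal_quotient_period.
have cc := cfrac_convergent cf k; rewrite per in cc.
set x := y 0%N in y1 per cc *.
(* The second root of the fixed-point equation of the period matrix, read off the product of the
   roots [- P_k / Q_(k+1)]. *)
pose x' := - sp (cnum b k) / (sp (cden b k.+1) * x).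
have x0 : x != 0 by rewrite -(nu_gt0 R) (lt_trans ltr01).
have Q0 : sp (cden b k.+1) != 0 by rewrite -(nu_gt0 R) (nu_cden_gt0 cf).
have vieta_prod : sp (cden b k.+1) * (x * x') = - sp (cnum b k).
  by rewrite /x'; field; rewrite Q0 x0.
have vieta_sum : sp (cden b k.+1) * (x + x') = sp (cnum b k.+1) - sp (cden b k).
  apply: (mulIf x0); rewrite mulrDr mulrDl.
  have -> : sp (cden b k.+1) * x' * x = - sp (cnum b k).
    by rewrite -vieta_prod; ring.
  have -> : sp (cnum b k) = x * (x * sp (cden b k.+1) + sp (cden b k)) -
    x * sp (cnum b k.+1) by rewrite cc addrC addKr.
  by ring.
(* Since [|x Q_(k+1)| = |P_(k+1)|], the size of [x'] is [|P_k| / |P_(k+1)|]. *)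
have x'1 : v x' < 1.
  rewrite /x' nuM nuN nuV nuM mulrC ltr_pdivrMl ?mulr_gt0 ?(nu_cden_gt0 cf) //;
    last exact: lt_trans ltr01 _.
  by rewrite mulr1 mulrC -(nu_cnum cf) // (cnum_lt cf).
have x'fix : x' * (x' * sp (cden b k.+1) + sp (cden b k)) =
    x' * sp (cnum b k.+1) + sp (cnum b k).
  have -> : sp (cnum b k) = - (sp (cden b k.+1) * (x * x')) by rewrite vieta_prod opprK.
  have -> : sp (cden b k) = sp (cnum b k.+1) - sp (cden b k.+1) * (x + x').
    by rewrite vieta_sum; ring.
  by ring.
exists b, y, x'; split=> //.
- split.
    split; first exact: cfrac_irr cf.
    exists (cden b k.+1), (cnum b k.+1 - cden b k), (- cnum b k).
    by rewrite rmorphB rmorphN -(sp_eq0 R).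
  apply: (periodic_gap (k := k) cf) => // n.
  rewrite !nu_sp_deg // -exprD ler_eXn2l //; exact: universal_quotient_adj.
- move=> p w pX wm pw; have [i bi] := block_occurs (mem_blocks pX wm pw).
  exists i; split; first by have := bi 0%N isT; rewrite addn0.
  by apply: starts_cfrac cf _ => j jw; rewrite addSnnS; exact: (bi j.+1).
Qed.

End Universal.

(** * Approximation by the orbit *)

Section UpperBound.
Variables (F : finFieldType) (R : realType) (m : nat).

Local Notation v := (nu R).
Local Notation q := (#|F|%:R : R).

(** The convergent matrix of [f] maps a tail [x] and its conjugate [t] to [z] and [z']. Then
    [|z - z'| = 1/(|Q2| |D'|)] and [|f - z| = |1/x - 1/f_(k+2)| / |Q2|^2], so everything rests on
    the size of [D'] and on the closeness of the inverses. *)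
Lemma orbit_approximation (b c : nat -> {poly F}) (y f : nat -> ser F)
    (x' : ser F) (eps : R) :
  (1 < m)%N -> cfrac R b y -> (forall n, (1 < size (b n))%N) -> v x' < 1 ->
  (forall p w, p \in [:: 'X; 'X + 1] -> w \in words F m m -> path (adj m) p w ->
     exists i, b i = p /\ starts R w (y i.+1)) ->
  cfrac R c f -> 0 < eps ->
  exists z z', [/\ hom2 (y 0%N) x' z z', 0 < v (z - z') < eps &
    v (f 0%N - z) <= q ^- m * v (z - z')].
Proof.
move=> m1 cy hb x'1 univ cf eps0.
(* With this [k], [|Q2| >= q^(k+1)] and [|D'| >= 1/q] make [|z - z'|] at most [q^-k < eps]. *)
have [k hk] := q_archi F eps^-1.
(* Since [p] differs from [c k.+1], the conjugate [z'] leaves [z] right after the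
   common convergent, so that [z - z'] is small. *)
pose p : {poly F} := if c k.+1 == 'X then 'X + 1 else 'X.
have p2 : size p = 2%N by rewrite /p; case: ifP; rewrite ?size_polyX ?size_XaddC.
have pX : p \in [:: 'X; 'X + 1] by rewrite /p; case: ifP; rewrite !inE eqxx ?orbT.
have pc : c k.+1 != p.
  rewrite /p; case: ifP => [/eqP ->|/negbT //].
  by rewrite -subr_eq0 opprD addNKr oppr_eq0 oner_eq0.
have [w [wm pw close]] : exists w, [/\ w \in words F m m, path (adj m) p w &
    forall x, starts R w x ->
      v (x^-1 - (f k.+2)^-1) <= q ^- (minn (m - (size p).-1) m)].
  by apply: words_dense; rewrite // p2.
have [i [bi yw]] := univ p w pX wm pw.
have tail := tail_hom2 cy hb x'1 i.+1.
have := conj_tail_lt1 hb x'1 i.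
move: tail (close _ yw) => /=; rewrite bi.
(* [u] is the conjugate of the tail whose first quotient is [p], and [t] that of the next tail [x];
   their sizes are below 1 and equal to [1/q]. *)
set u := conj_tail b x' i; set x := y i.+1; set t := (u - sp p)^-1.
move=> tail + u1.
rewrite p2 subn1 (minn_idPl (leq_pred m)) => {}close.
have x1 : 1 < v x := starts_gt1 yw.
have x0 : x != 0 by rewrite -(nu_gt0 R) (lt_trans ltr01).
have g1 : 1 < v (f k.+2) := cfrac_gt1 cf _.
have g0 : f k.+2 != 0 := cfrac_neq0 cf _.
have vp : v (sp p) = q by rewrite nu_sp_deg p2.
have up : v (u - sp p) = q by rewrite nuBr vp // (lt_trans u1).
have up0 : u - sp p != 0 by rewrite -(nu_gt0 R) up.
have vt : v t = q^-1 by rewrite nuV up.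
set Q2 := sp (cden c k.+2); set Q1 := sp (cden c k.+1).
set P2 := sp (cnum c k.+2); set P1 := sp (cnum c k.+1).
have X0 : 0 < v Q2 := nu_cden_gt0 cf _; have W0 : 0 < v Q1 := nu_cden_gt0 cf _.
have W1 : 1 <= v Q1 := nu_cden_ge1 cf _.
have Xk : q ^+ k.+1 <= v Q2 := nu_cden_ge cf _.
have WX : v Q1 <= v Q2 / q.
  rewrite ler_pdivlMr // mulrC /Q2 (nu_cdenSS cf) ler_pM2r // q_le_nu_sp //.
  exact: size_quotient cf k.
pose D := x * Q2 + Q1; pose D' := t * Q2 + Q1.
have vD : v D = v x * v Q2 by exact: (nu_complete_den cf).
(* Factoring out [t] exposes [(c_(k+1) - p) Q1], which dominates since [p] differs from [c_(k+1)];
   this keeps [D'] from being too small. *)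
have D'E : D' = t * ((sp (c k.+1) - sp p) * Q1 + (sp (cden c k) + u * Q1)).
  have -> : (sp (c k.+1) - sp p) * Q1 + (sp (cden c k) + u * Q1) =
    Q2 + (u - sp p) * Q1 by rewrite /Q2 cdenSS rmorphD rmorphM /= -/Q1; ring.
  by rewrite mulrDr mulrA mulVf // mul1r.
have D'ge : v Q1 / q <= v D'.
  rewrite D'E nuM vt mulrC ler_pM2l ?invr_gt0 //.
  have big : v Q1 <= v ((sp (c k.+1) - sp p) * Q1).
    by rewrite nuM -rmorphB ler_peMl // nu_sp_ge1 // subr_eq0.
  rewrite nuDl //; apply: lt_le_trans big; apply: nuD_lt; first exact: cden_lt cf k.
  by rewrite nuM gtr_pMl.
have D'le : v D' <= v Q2 / q.
  by apply: nuD_le => //; rewrite nuM vt mulrC.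
have D'gt0 : 0 < v D' by rewrite (lt_le_trans _ D'ge) // divr_gt0.
have D0 : D != 0 by rewrite -(nu_gt0 R) vD mulr_gt0 // (lt_trans ltr01).
have D'0 : D' != 0 by rewrite -(nu_gt0 R).
pose z := (x * P2 + P1) / D; pose z' := (t * P2 + P1) / D'.
have zE : z * D = x * P2 + P1 by rewrite /z mulfVK.
have z'E : z' * D' = t * P2 + P1 by rewrite /z' mulfVK.
have det1 : v (P2 * Q1 - P1 * Q2) = 1.
  by rewrite /P2 /P1 /Q1 /Q2 sp_convergent_det nu_sign.
have E1 := @homography_diff _ P2 P1 Q2 Q1 x t z z'.
have E2 := @homography_diff _ P2 P1 Q2 Q1 (f k.+2) x (f 0%N) z.
rewrite (mulrC Q2 x) (mulrC Q2 t) (mulrC P2 x) (mulrC P2 t) in E1.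
rewrite (mulrC Q2 x) (mulrC Q2 (f _)) (mulrC P2 x) (mulrC P2 (f _)) in E2.
have fE : f 0%N * (f k.+2 * Q2 + Q1) = f k.+2 * P2 + P1 := cfrac_convergent cf _.
have vDf : v (f k.+2 * Q2 + Q1) = v (f k.+2) * v Q2 by exact: (nu_complete_den cf).
have Df0 : f k.+2 * Q2 + Q1 != 0.
  by rewrite -(nu_gt0 R) vDf mulr_gt0 // (lt_trans ltr01).
have {}E1 : v (z - z') = (v Q2 * v D')^-1.
  rewrite E1 // nuM nuV !nuM det1 mul1r vD nuBl.
    by field; rewrite !gt_eqF // (lt_trans ltr01).
  by rewrite vt (lt_trans _ x1) // invf_lt1.
have {}E2 : v (f 0%N - z) = v (x^-1 - (f k.+2)^-1) / (v Q2 * v Q2).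
  rewrite E2 // nuM nuV !nuM det1 mul1r vD vDf nu_inv_diff // nuBC.
  by field; rewrite !gt_eqF // (lt_trans ltr01).
exists z, z'; split.
- apply: hom2_trans tail _.
  exists (cnum c k.+2), (cnum c k.+1), (cden c k.+2), (cden c k.+1).
  by rewrite convergent_unit ![sp _ * x]mulrC ![sp _ * t]mulrC.
- rewrite E1 invr_gt0 mulr_gt0 //= invf_plt ?posrE ?mulr_gt0 //.
  apply: lt_le_trans hk _; apply: le_trans (_ : _ <= q ^+ k.+1 / q) _.
    by rewrite exprSr mulfK ?q_neq0.
  apply: le_trans (_ : _ <= v Q2 / q) _; first by rewrite ler_pM2r ?invr_gt0.
  rewrite ler_pM2l //; apply: le_trans D'ge.
  by rewrite -[leLHS]mul1r ler_pM2r ?invr_gt0.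
rewrite E1 E2 invfM mulrA [leLHS](_ : _ = v (x^-1 - (f k.+2)^-1) / v Q2 / v Q2);
  last by field; rewrite gt_eqF.
rewrite [leRHS](_ : _ = q ^- m / v D' / v Q2); last by field; rewrite !gt_eqF ?exprn_gt0.
rewrite ler_pM2r ?invr_gt0 // ler_pdivrMr // mulrAC ler_pdivlMr //.
(* One factor [q] moves to [Q2]: the claim becomes the product of [close], with exponent [m - 1],
   and of [D'le]. *)
have -> : q ^- m * v Q2 = q ^- m.-1 * (v Q2 / q).
  by rewrite -{1}(prednK (ltnW m1)) exprSr; field; rewrite expf_neq0 ?q_neq0.
by apply: ler_pM.
Qed.

End UpperBound.

(** * Dictionary between the raw definitions and the field of series *)

Section Translation.
Variables (F : finFieldType) (R : realType).
Implicit Types x y z : ser F.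

Lemma KhatP (f : LS F) : f \in @Khat F -> exists x : ser F, f = x.
Proof. by rewrite inE => hf; exists (mkser hf). Qed.

Lemma ser_Khat x : ser_val x \in @Khat F.
Proof. by rewrite inE; exact: serP. Qed.

Lemma ser_val0 : (fun _ => 0) = ser_val (0 : ser F).
Proof. by apply/funext => n; rewrite ser0. Qed.

Lemma inKP x : ~ inK x <-> irr x.
Proof.
split=> [h P Q Q0 E|xi [P [Q [Q0 E]]]].
  by apply: h; exists P, Q; split=> //; rewrite -[LHS]/(ser_val (sp Q * x)) E.
exact: xi P Q Q0 (@ser_inj _ (sp Q * x) (sp P) E).
Qed.

Lemma galconjP x y : galconj x y <-> qconj x y.
Proof.
split.
  move=> [[_ [/inKP xi _]] [_ [A [B [C [A0 [E E']]]]]]].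
  split=> //; exists A, (- B), C; split=> //; first exact: (@ser_inj _ (sp A * (x + y)) (sp (- B)) E').
  have {}E : sp A * (x * x) + sp B * x + sp C = 0.
    by apply: (@ser_inj _ (sp A * (x * x) + sp B * x + sp C) 0); rewrite -ser_val0 -E.
  have {}E' : sp A * (x + y) = sp (- B).
    exact: (@ser_inj _ (sp A * (x + y)) (sp (- B)) E').
  apply: (addrI (sp A * (x * x))); rewrite -mulrDr -mulrDr mulrCA E' rmorphN.
  by apply/eqP; rewrite -subr_eq0 -oppr_eq0 -E; apply/eqP; ring.
move=> xy; have [xi [A [B [C [A0 E E']]]]] := xy.
have E2 : sp A * (x * x) + sp (- B) * x + sp C = 0.
  by rewrite rmorphN /= -E -E'; ring.
have EL : ls_add (ls_add (ls_mul (ls_poly A) (ls_mul x x)) (ls_mul (ls_poly (- B)) x))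
    (ls_poly C) = (fun _ => 0) by rewrite ser_val0 -E2.
split; first split; [exact: ser_Khat| |].
  split; first exact/inKP.
  by exists A, (- B), C; split=> //; left.
split; first exact: ser_Khat.
exists A, (- B), C; split=> //; split=> //.
by rewrite opprK -[LHS]/(ser_val (sp A * (x + y))) E.
Qed.

Lemma homog_imageP x y : irr x -> homog_image x y <->
  exists a b c d : {poly F}, a * d - b * c \is a GRing.unit /\
    y * (sp c * x + sp d) = sp a * x + sp b.
Proof.
move=> xi; split.
  by move=> [_ [a [b [c [d [u [_ E]]]]]]]; exists a, b, c, d; split=> //;
    exact: (@ser_inj _ (y * (sp c * x + sp d)) (sp a * x + sp b) E).
move=> [a [b [c [d [u E]]]]]; split; first exact: ser_Khat.
exists a, b, c, d; split=> //; split; last first.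
  by rewrite -[LHS]/(ser_val (y * (sp c * x + sp d))) E.
rewrite ser_val0 => D0; have := hom_den_neq0 R xi u.
by rewrite (@ser_inj _ (sp c * x + sp d) 0 D0) eqxx.
Qed.

Lemma ThetaP x x' z : qconj x x' ->
  Theta x z <-> (exists z', hom2 x x' z z') \/ (exists z', hom2 x' x z z').
Proof.
move=> xx'; have x'i := qconj_irr xx'; have xi := xx'.1.
have fill s s' (a b c d : {poly F}) : irr s' -> a * d - b * c \is a GRing.unit ->
    z * (sp c * s + sp d) = sp a * s + sp b -> exists z', hom2 s s' z z'.
  move=> s'i u E; exists ((sp a * s' + sp b) / (sp c * s' + sp d)).
  by exists a, b, c, d; split=> //; rewrite mulfVK // (hom_den_neq0 R s'i u).
split.
  move=> [f [hf h]]; have [y yE] : exists y : ser F, f = y.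
    by apply: KhatP; case: hf => _ [].
  move: hf h; rewrite yE => /galconjP xy.
  rewrite (qconj_unique R xy xx') => -[|] /homog_imageP.
    by case=> // a [b [c [d [u E]]]]; left; exact: fill u E.
  by case=> // a [b [c [d [u E]]]]; right; exact: fill u E.
move=> h; exists x'; split; first exact/galconjP.
case: h => -[z' [a [b [c [d [u E _]]]]]]; [left|right].
  by apply/homog_imageP => //; exists a, b, c, d.
by apply/homog_imageP => //; exists a, b, c, d.
Qed.

(** Uniqueness of the conjugate forces the given [z'] to be the image of the other root under the
    matrix that produces [z]. *)
Lemma Theta_pair x x' z z' : qconj x x' -> Theta x z -> galconj z z' ->
  hom2 x x' z z' \/ hom2 x' x z z'.
Proof.
move=> xx' /(ThetaP _ xx') [] [t h] /galconjP zz'; [left|right].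
  have [a [b [c [d [u E E']]]]] := h.
  by rewrite -(qconj_unique R (hom_qconj R xx' u E E') zz').
have [a [b [c [d [u E E']]]]] := h.
by rewrite -(qconj_unique R (hom_qconj R (qconj_sym xx') u E E') zz').
Qed.

End Translation.

(** * The Hurwitz constant of the universal element *)

Theorem theorem1p4 (F : finFieldType) (R : realType) (m : nat) (hm : (2 <= m)%N) :
  exists alpha : LS F, K2 alpha /\
    Hw_eq R alpha (((#|F|%:R : R) ^ (- (m%:Z)))%:E).
Proof.
have [b [y [x' [cy hb [x'1 x1] [xx' gp] univ]]]] := universal_exists F R hm.
set x := y 0%N in x1 xx' gp.
have xi : irr x := xx'.1; have x'i := qconj_irr xx'.
have nxx' : x != x' by apply: contraTneq x1 => ->; rewrite -leNgt ltW.
have sep (z z' : ser F) : Theta x z -> galconj z z' -> gap R m z z' /\ z != z'.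
  move=> Tz zz'; case: (Theta_pair R xx' Tz zz') => -[a [e [c [d [u E E']]]]].
    by have [g n] := hom_gap xi x'i u E E' gp; split=> //; exact: n.
  have [g n] := hom_gap x'i xi u E E' (gap_sym gp).
  by split=> //; apply: n; rewrite eq_sym.
exists x; split; first by case: (proj2 (galconjP x x') xx').
rewrite -exprnN.
have upper (f : LS F) : f \in @Khat F -> ~ inK f ->
    (c_alpha R x f <= ((#|F|%:R : R) ^- m)%:E)%E.
  move=> /KhatP[g ->] /inKP gi; have [c [s [cs s0]]] := irr_cfrac R gi.
  apply: ge_ereal_sup => _ [eps /= eps0 <-].
  have [z [z' [h /andP[d0 de] close]]] :=
    orbit_approximation hm cy hb x'1 univ cs eps0.
  apply: le_trans (_ : _ <= (nu R (g - z) / nu R (z - z'))%:E)%E _.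
    apply: ereal_inf_lbound; exists z, z'; split.
      by apply/(ThetaP R _ xx'); left; exists z'.
    split=> //; case: h => a [e [k [d [u E E']]]].
    exact/galconjP/(hom_qconj R xx' u E E').
  by rewrite lee_fin ler_pdivrMr // -s0.
(* The extremal point has all partial quotients of degree [m + 1], so that they exceed [q^m] in size
   as [gap_far] requires. *)
pose c0 (n : nat) : {poly F} := 'X^(m.+1).
have [s [cs s1]] : exists s, cfrac R c0 s /\ 1 < nu R (s 0%N).
  by apply: cfrac_exists => n; rewrite size_polyXn.
have far (z z' : ser F) : Theta x z -> galconj z z' ->
    (#|F|%:R : R) ^- m * nu R (z - z') <= nu R (s 0%N - z).
  move=> Tz zz'; have [g n] := sep z z' Tz zz'.
  apply: gap_far g n cs _ => n'; rewrite nu_sp_deg size_polyXn //=.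
  by rewrite ltr_eXn2l ?q_gt1.
have sK : ~ inK (s 0%N) by apply/inKP; exact: cfrac_irr cs.
(* A point of the orbit is at distance 0 from itself, against the positive lower bound [far]. *)
have sT : ~ Theta x (s 0%N).
  move=> T; have [z' zz'] : exists z', galconj (s 0%N) (ser_val z').
    case: (proj1 (ThetaP R _ xx') T) => -[z' [a [e [k [d [u E E']]]]]]; exists z'.
      exact/galconjP/(hom_qconj R xx' u E E').
    exact/galconjP/(hom_qconj R (qconj_sym xx') u E E').
  have [_ n] := sep _ _ T zz'; have := far _ _ T zz'.
  by rewrite subrr nu0 leNgt mulr_gt0 ?qV_gt0 // nu_gt0 subr_eq0.
split; last by move=> _ [f [fK [fi _]] <-]; exact: upper.
exists (s 0%N); first by split; [exact: ser_Khat|].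
apply/eqP; rewrite eq_le upper ?ser_Khat //=.
(* The lower bound holds on the whole orbit, so the single value [eps = 1] already bounds the
   supremum from below. *)
apply: le_trans (_ : _ <= ereal_inf _)%E _; last first.
  by apply: ereal_sup_ubound; exists 1; [exact: ltr01|reflexivity].
apply: le_ereal_inf_tmp => _ [f [f' [Tf [ff' [_ ->]]]]].
have [z zE] : exists z : ser F, f = z by apply: KhatP; case: ff' => [[]].
have [z' z'E] : exists z : ser F, f' = z by apply: KhatP; case: ff' => _ [].
move: Tf ff'; rewrite zE z'E => Tz zz'.
have [_ n] := sep z z' Tz zz'.
rewrite lee_fin -/(nu R (s 0%N - z)) -/(nu R (z - z')) ler_pdivlMr ?far //.
by rewrite nu_gt0 subr_eq0.
Qed.
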